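(* Let $s\in(0,1)$, let $\Omega\subset\mathbb{R}^n$ be a bounded open set with $C^{1,1}$ boundary and let $v:\mathbb{R}^n\to\mathbb{R}$ be locally bounded. There exists a constant $M=M(n,s,\Omega,v)>0$ such that if $E\subset\mathbb{R}^{n+1}$ is locally $s$-minimal in $\Omega^\infty$, with $E\setminus\Omega^\infty=\mathcal{S}g(v)\setminus\Omega^\infty$, then $$\Omega\times(-\infty,-M]\subset E\cap\Omega^\infty\subset\Omega\times(-\infty,M].$$ As a consequence, $$E\setminus\big(\Omega\times[-M,M]\big)=\mathcal{S}g(v)\setminus\big(\Omega\times[-M,M]\big).$$
   Context: $\Omega^\infty=\Omega\times\mathbb{R}\subset\mathbb{R}^{n+1}$. $\mathcal{S}g(v)=\{(x,t)\in\mathbb{R}^{n+1} : t<v(x)\}$ is the subgraph of $v$. $v$ locally bounded means $\sup_{|x|\leq r}|v(x)|<\infty$ for every $r>0$. All sets and functions are Lebesgue measurable; equalities and inclusions of sets are understood up to measure zero. In $\mathbb{R}^{n+1}$: for disjoint $A,B\subset\mathbb{R}^{n+1}$ put $\mathcal{L}_s(A,B)=\int_A\int_B\frac{dX\,dY}{|X-Y|^{n+1+s}}\in[0,\infty]$. For $E\subset\mathbb{R}^{n+1}$ and an open set $U\subset\mathbb{R}^{n+1}$, writing $E^c=\mathbb{R}^{n+1}\setminus E$, $$P_s(E,U)=\mathcal{L}_s(E\cap U,E^c\cap U)+\mathcal{L}_s(E\cap U,E^c\setminus U)+\mathcal{L}_s(E\setminus U,E^c\cap U).$$ $E$ is $s$-minimal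 in $U$ if $P_s(E,U)<\infty$ and $P_s(E,U)\leq P_s(F,U)$ for every $F\subset\mathbb{R}^{n+1}$ with $F\setminus U=E\setminus U$. $E$ is locally $s$-minimal in $U$ if it is $s$-minimal in every open set $U'\subset\subset U$, where $A\subset\subset B$ means that $\overline{A}$ is compact and $\overline{A}\subset B$. *)

(* Defs.v *)
From HB Require Import structures.
From mathcomp Require Import all_boot all_order all_algebra.
From mathcomp Require Import all_classical all_reals all_analysis.

Set Implicit Arguments.
Unset Strict Implicit.
Unset Printing Implicit Defensive.

Import Order.TTheory GRing.Theory Num.Theory.
Import numFieldNormedType.Exports.

Local Open Scope classical_set_scope.
Local Open Scope ring_scope.

(* R^d is ['rV[R]_d].  Its topology is the library one (induced by the sup
   norm, hence the usual one); [enorm] is the Euclidean norm.  A point of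
   R^(n+1) = R^n * R is written X = (x, t) with x = [base X], t = [height X]. *)

Definition enorm (R : realType) (d : nat) (x : 'rV[R]_d) : R :=
  Num.sqrt (\sum_(i < d) x 0 i ^+ 2).

Definition base (R : realType) (n : nat) (X : 'rV[R]_(n + 1)) : 'rV[R]_n :=
  lsubmx X.

Definition height (R : realType) (n : nat) (X : 'rV[R]_(n + 1)) : R :=
  rsubmx X 0 0.

Definition cylinder (R : realType) (n : nat) (A : set 'rV[R]_n) (I : set R) :
    set 'rV[R]_(n + 1) :=
  [set X | A (base X) /\ I (height X)].

Definition subgraph (R : realType) (n : nat) (v : 'rV[R]_n -> R) :
    set 'rV[R]_(n + 1) :=
  [set X | height X < v (base X)].

Definition locally_bounded (R : realType) (n : nat) (v : 'rV[R]_n -> R) :=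
  forall r : R, 0 < r ->
    exists C : R, forall x, enorm x <= r -> `|v x| <= C.

(* The Lebesgue outer measure is the infimum of the total volume over the
   countable families of half-open boxes covering the set; a pair [Q] encodes
   the box with corners [Q.1] and [Q.2].  The Lebesgue measure is its
   restriction to the Caratheodory-measurable sets. *)

Definition box (R : realType) (d : nat) (Q : 'rV[R]_d * 'rV[R]_d) :
    set 'rV[R]_d :=
  [set x | forall i, Q.1 0 i < x 0 i <= Q.2 0 i].

Definition box_volume (R : realType) (d : nat) (Q : 'rV[R]_d * 'rV[R]_d) : R :=
  \prod_(i < d) Num.max 0 (Q.2 0 i - Q.1 0 i).

Definition lebesgue_outer (R : realType) (d : nat) (A : set 'rV[R]_d) :
    \bar R :=
  ereal_inf [set \esum_(Q in C) (box_volume Q)%:E | C in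
    [set C | countable C /\ A `<=` \bigcup_(Q in C) box Q]].

Section lebesgue_outer_measure.
Variables (R : realType) (d : nat).
Local Open Scope ereal_scope.
Local Notation mu := (@lebesgue_outer R d).
Local Notation vol := (@box_volume R d).

Let vol_ge0 Q : 0 <= (vol Q)%:E.
Proof. by rewrite lee_fin; apply: prodr_ge0 => i _; rewrite le_max lexx. Qed.

Let mu0 : mu set0 = 0.
Proof.
apply/eqP; rewrite eq_le; apply/andP; split.
  apply: ereal_inf_lbound; exists set0; last by rewrite esum_set0.
  by split=> //; exact: countable0.
by apply: le_ereal_inf_tmp => _ [C _ <-]; exact: esum_ge0.
Qed.

Let mu_ge0 A : 0 <= mu A.
Proof. by apply: le_ereal_inf_tmp => _ [C _ <-]; exact: esum_ge0. Qed.

Let le_mu : {homo mu : A B / A `<=` B >-> A <= B}.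
Proof.
move=> A B AB; apply/ereal_inf_le_tmp => _ [C [cC BC] <-].
by exists C => //; split=> //; exact: subset_trans BC.
Qed.

Let esum_bigcup_le (C : nat -> set ('rV[R]_d * 'rV[R]_d)) :
  \esum_(Q in \bigcup_n C n) (vol Q)%:E <=
  \sum_(n <oo) \esum_(Q in C n) (vol Q)%:E.
Proof.
have [k kP] : {k : 'rV[R]_d * 'rV[R]_d -> nat &
    forall Q, (\bigcup_n C n) Q -> C (k Q) Q}.
  apply: (@choice _ _ (fun Q n => (\bigcup_n C n) Q -> C n Q)) => Q.
  have [[n _ CnQ]|nQ] := pselect ((\bigcup_n C n) Q); first by exists n.
  by exists 0%N.
pose J n := [set Q | (\bigcup_n C n) Q /\ k Q = n].
have -> : \bigcup_n C n = \bigcup_n J n.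
  apply/seteqP; split=> Q; last by move=> [n _ []].
  by move=> CQ; exists (k Q).
rewrite esum_bigcupT//; last first.
  apply/trivIsetP => i j _ _ /eqP ij; apply/seteqP; split=> // Q.
  by move=> [[_ kQi] [_ kQj]]; apply: ij; rewrite -kQi -kQj.
rewrite nneseries_esumT; last by move=> n; exact: esum_ge0.
apply: le_esum => n _; apply: ge_ereal_sup => _ [X [finX XJ] <-].
apply: ereal_sup_ubound; exists X => //; split=> // Q /XJ [CQ <-].
exact: kP.
Qed.

Let mu_sigma_subadditive : sigma_subadditive mu.
Proof.
move=> A; have [[i ioo]|] := pselect (exists i, mu (A i) = +oo).
  rewrite (eseries_pinfty _ _ ioo) ?leey// => n _.
  by rewrite -ltNye (lt_le_trans _ (mu_ge0 _)).
rewrite -forallNE => Aoo.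
suff add2e (e : {posnum R}) :
    mu (\bigcup_n A n) <= \sum_(i <oo) mu (A i) + e%:num%:E.
  by apply/lee_addgt0Pr => _/posnumP[].
rewrite (le_trans _ (epsilon_trick _ _ _))//.
pose P n C := (countable C /\ A n `<=` \bigcup_(Q in C) box Q) /\
  \esum_(Q in C) (vol Q)%:E <= mu (A n) + (e%:num / (2 ^ n.+1)%:R)%:E.
have [C PC] : {C & forall n, P n (C n)}.
  apply: (@choice _ _ P) => n; rewrite /P.
  have en1 : (0 < e%:num / (2 ^ n.+1)%:R)%R by [].
  have muAfin : mu (A n) \is a fin_num.
    by rewrite ge0_fin_numE// ltey; apply/eqP; exact: Aoo.
  have [_ [C [cC AC] <-] Clt] := lb_ereal_inf_adherent en1 muAfin.
  by exists C; split=> //; exact: ltW.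
apply: (@le_trans _ _ (\esum_(Q in \bigcup_n C n) (vol Q)%:E)).
  apply: ereal_inf_lbound; exists (\bigcup_n C n) => //; split.
    by apply: bigcup_countable => // n _; exact: (PC n).1.1.
  move=> x [n _ /((PC n).1.2)] [Q CnQ Qx].
  by exists Q => //; exists n.
apply: (le_trans (esum_bigcup_le C)).
by apply: lee_nneseries => n _; [move=> _; exact: esum_ge0|exact: (PC n).2].
Qed.

HB.instance Definition _ := isOuterMeasure.Build R 'rV[R]_d mu
  mu0 mu_ge0 le_mu mu_sigma_subadditive.

End lebesgue_outer_measure.

(* [lebesgue_space R d] is R^d with its Lebesgue-measurable sets, on which
   [lebesgue R d] is a (complete) measure. *)

Notation lebesgue_space R d := (caratheodory_type (@lebesgue_outer R d)).

Notation lebesgue R d :=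
  (@lebesgue_outer R d : set (lebesgue_space R d) -> \bar R).

Definition lebesgue_measurable (R : realType) (d : nat) (A : set 'rV[R]_d) :=
  measurable (A : set (lebesgue_space R d)).

Definition lebesgue_measurable_fun (R : realType) (d : nat)
    (f : 'rV[R]_d -> R) :=
  measurable_fun [set: lebesgue_space R d] (f : lebesgue_space R d -> R).

Definition subset_ae (R : realType) (d : nat) (A B : set 'rV[R]_d) :=
  {ae lebesgue R d, forall X, A X -> B X}.

Definition eqset_ae (R : realType) (d : nat) (A B : set 'rV[R]_d) :=
  {ae lebesgue R d, forall X, A X <-> B X}.

(* For d = n + 1 the kernel is |X - Y|^-(n + 1 + s). *)

Section fractional_perimeter.
Variables (R : realType) (d : nat) (s : R).
Local Open Scope ereal_scope.
Implicit Types A B E F U : set 'rV[R]_d.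

Definition interaction A B : \bar R :=
  \int[lebesgue R d]_(X in A) \int[lebesgue R d]_(Y in B)
    ((enorm ((X : 'rV[R]_d) - (Y : 'rV[R]_d)) `^ (d%:R + s))^-1)%:E.

Definition perimeter E U : \bar R :=
  interaction (E `&` U) (~` E `&` U) +
  interaction (E `&` U) (~` E `\` U) +
  interaction (E `\` U) (~` E `&` U).

Definition minimal E U :=
  perimeter E U < +oo /\
  forall F, lebesgue_measurable F -> eqset_ae (F `\` U) (E `\` U) ->
    perimeter E U <= perimeter F U.

End fractional_perimeter.

Definition compactly_contained (R : realType) (d : nat)
    (A B : set 'rV[R]_d) :=
  compact (closure A) /\ closure A `<=` B.

Definition locally_minimal (R : realType) (d : nat) (s : R)
    (E U : set 'rV[R]_d) :=
  forall U', open U' -> compactly_contained U' U -> minimal s E U'.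

(* Near each boundary point the set is, after an orthogonal change of
   coordinates, the strict epigraph of a C^{1,1} function of n - 1 variables.
   [Q] is square since n.-1 + 1 = n for n > 0; splitting its rows this way
   makes [base] and [height] available for the rotated point [x *m Q^T]. *)

Definition gradient (R : realType) (d : nat) (g : 'rV[R]_d -> R)
    (x : 'rV[R]_d) : 'rV[R]_d :=
  \row_(i < d) 'D_(delta_mx 0 i) g x.

Definition C11_function (R : realType) (d : nat) (g : 'rV[R]_d -> R) :=
  (forall x, differentiable g x) /\ exists L : R, L.-lipschitz (gradient g).

Definition C11_boundary (R : realType) (n : nat) (Omega : set 'rV[R]_n) :=
  forall p, (closure Omega `\` interior Omega) p ->
    exists (r : R) (Q : 'M[R]_(n.-1 + 1, n)) (g : 'rV[R]_(n.-1) -> R),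
      [/\ 0 < r, Q *m Q^T = 1%:M, C11_function g &
        forall x, enorm (x - p) < r ->
          (Omega x <-> g (base (x *m Q^T)) < height (x *m Q^T))].

(* Main.v *)
(* Cutting off part of E inside the cylinder yields, for an s-minimal set, the
   one-sided inequality L_s(A, E^c) <= L_s(E \ A, A) for A contained in E and
   well inside the cylinder.  Since the boundary layer {dist(., Omega^c) < eta}
   has measure O(eta) and s < 1, suitable layers interact with their complement
   by an arbitrarily small amount, so that A may be taken to be the whole slab
   A_K = E /\ Omega x (p - K, p + K).

   Where E lies below the graph of v near the cylinder, E \ A_K consists of
   points at height distance >= K from p and of points at horizontal distance
   >= R_0; the latter contribute at most C R_0^(-s) |A_K|, which is absorbed by
   the isoperimetric bound c r^(-s) |A_K| <= L_s(A_K, A_K^c), valid at any scale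
   r for which A_K fills at most half of every cube of size r.  Averaging the
   remaining term over K in (K_1, K_2) gives
     |A_(K_1)| <= C (r / (K_2 - K_1))^s |A_(K_2)|.
   As Omega is bounded, the scale r = r_0 is always allowed; using it repeatedly
   with long steps makes |A_K| small on a slab of bounded height, and a
   De Giorgi iteration with r_k and K_k - K_(k+1) both of order 2^(-k) then gives
   |A_1| = 0.  All constants are uniform in p and E.  The lower bound for E
   follows by applying this to E^c. *)

Require Import Defs.
From HB Require Import structures.
From mathcomp Require Import all_boot all_order all_algebra.
From mathcomp Require Import all_classical all_reals all_analysis.
From mathcomp Require Import measurable_realfun ring lra.

Import Order.TTheory GRing.Theory Num.Theory.
Import numFieldNormedType.Exports.

Local Open Scope classical_set_scope.
Local Open Scope ring_scope.

Set Implicit Arguments.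
Unset Strict Implicit.
Unset Printing Implicit Defensive.

(** * Lebesgue measure on R^d *)

(** The choice of the lateral layer and the decay between slabs rest on one averaging principle for
    a 1-Lipschitz function phi: a point with phi < K feels {phi >= K} with a potential of order (K -
    phi)^(-s), and this is integrable in K. It is applied once with phi the distance to the
    complement of Omega and once with phi the height distance to p. The layer is unavoidable because
    competitors may differ from E only in sets compactly contained in the cylinder, whereas a slab
    may reach the lateral boundary. The second iteration closes because the decay factor depends on
    r / (K_2 - K_1) only. When both are halved at each step the factor stays constant, and a factor
    at most 2^(-d), d = n + 1, reproduces the scaling of the volume of half a cube: the condition
    that permits the scale r_k thus passes on to r_(k+1). *)

(** Sums over covers become series over [nat], which can be exchanged with integrals; indices
    outside [P] contribute 0, which includes finite [C]. *)
Lemma countable_enum (R : realType) (T : pointedType) (C : set T) :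
  countable C ->
  exists (g : nat -> T) (P : set nat), C = g @` P /\
    forall a : T -> \bar R, (forall x, 0 <= a x)%E ->
      (\esum_(x in C) a x = \sum_(i <oo) (if i \in P then a (g i) else 0))%E.
Proof.
move=> /countable_bijP [P]; rewrite card_eq_sym => /card_set_bijP [g [gf gi gs]].
have gPC : g @` P = C.
  by apply/seteqP; split=> // _ [x Px <-]; exact: gf.
exists g, P; split => // a a0.
by rewrite -gPC esum_set_image ?eseries_mkcond.
Qed.

Section lebesgue_boxes.
Variables (R : realType) (d : nat).
Implicit Types (A : set 'rV[R]_d) (Q : 'rV[R]_d * 'rV[R]_d).
Local Notation mu := (@lebesgue_outer R d).

Lemma box_volume_ge0 Q : 0 <= box_volume Q.
Proof. by apply: prodr_ge0 => i _; rewrite le_max lexx. Qed.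

Lemma outer_le_cover A (C : set ('rV[R]_d * 'rV[R]_d)) :
  countable C -> A `<=` \bigcup_(Q in C) box Q ->
  (mu A <= \esum_(Q in C) (box_volume Q)%:E)%E.
Proof. by move=> cC AC; apply: ereal_inf_lbound; exists C. Qed.

Lemma outer_box_le Q : (mu (box Q) <= (box_volume Q)%:E)%E.
Proof.
apply: (le_trans (outer_le_cover (countable1 Q) _)).
  by move=> x Qx; exists Q.
by rewrite esum_set1 ?lee_fin ?box_volume_ge0.
Qed.

Lemma outer_bigcup_le (T : pointedType) (C : set T) (F : T -> set 'rV[R]_d) :
  countable C -> (mu (\bigcup_(x in C) F x) <= \esum_(x in C) mu (F x))%E.
Proof.
move=> cC; have [g [P [CE ->//]]] := countable_enum R cC; last first.
  by move=> x; exact: outer_measure_ge0.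
pose G i := if i \in P then F (g i) else set0.
have -> : \bigcup_(x in C) F x = \bigcup_i G i.
  apply/seteqP; split=> x.
    move=> [y]; rewrite {1}CE => -[i Pi <-] Fx; exists i => //.
    by rewrite /G mem_set.
  move=> [i _]; rewrite /G; case: ifPn => // /set_mem Pi Fx.
  by exists (g i) => //; rewrite CE; exists i.
apply: (le_trans (outer_measure_sigma_subadditive mu G)).
rewrite le_eqVlt; apply/orP; left; apply/eqP; apply: eq_eseriesr => i _.
by rewrite /G; case: ifPn => // _; rewrite outer_measure0.
Qed.

Definition halfspace (i : 'I_d) (c : R) : set 'rV[R]_d := [set x | x 0 i <= c].

Definition setcoord (x : 'rV[R]_d) (i : 'I_d) (c : R) : 'rV[R]_d :=
  \row_j (if j == i then c else x 0 j).

(** The truncations by [Num.min] and [Num.max] make one piece have volume 0 when the hyperplane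
    misses the box. *)
Lemma volume_split Q i c :
  box_volume (Q.1, setcoord Q.2 i (Num.min c (Q.2 0 i))) +
  box_volume (setcoord Q.1 i (Num.max c (Q.1 0 i)), Q.2) = box_volume Q.
Proof.
rewrite /box_volume /= (bigD1 i)//= [X in _ + X](bigD1 i)//=.
rewrite [RHS](bigD1 i)//= !mxE eqxx.
have e1 : \prod_(j < d | j != i) Num.max 0
    (setcoord Q.2 i (Num.min c (Q.2 0 i)) 0 j - Q.1 0 j) =
    \prod_(j < d | j != i) Num.max 0 (Q.2 0 j - Q.1 0 j).
  by apply: eq_bigr => j /negPf ji; rewrite !mxE ji.
have e2 : \prod_(j < d | j != i) Num.max 0
    (Q.2 0 j - setcoord Q.1 i (Num.max c (Q.1 0 i)) 0 j) =
    \prod_(j < d | j != i) Num.max 0 (Q.2 0 j - Q.1 0 j).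
  by apply: eq_bigr => j /negPf ji; rewrite !mxE ji.
rewrite e1 e2 -mulrDl; congr (_ * _).
rewrite !maxEle !minEle.
by repeat case: ifPn; rewrite -?ltNge => *; lra.
Qed.

(** Caratheodory's condition holds because the hyperplane cuts every box of a cover into two boxes
    whose volumes add up. *)
Lemma halfspace_measurable i c : lebesgue_measurable (halfspace i c).
Proof.
apply: le_caratheodory_measurable => A.
apply: le_ereal_inf_tmp => _ [C [cC AC] <-].
apply: (@le_trans _ _ (\esum_(Q in C) mu (box Q `&` halfspace i c) +
                       \esum_(Q in C) mu (box Q `&` ~` halfspace i c))%E).
  apply: leeD.
    apply: le_trans (outer_bigcup_le _ cC); apply: le_outer_measure.
    by move=> x [/AC [Q CQ Qx] hx]; exists Q.
  apply: le_trans (outer_bigcup_le _ cC); apply: le_outer_measure.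
  by move=> x [/AC [Q CQ Qx] hx]; exists Q.
rewrite -esumD; try by move=> *; exact: outer_measure_ge0.
apply: le_esum => Q _; rewrite -(volume_split Q i c) EFinD; apply: leeD.
  apply: le_trans (outer_box_le _); apply: le_outer_measure.
  move=> x [Qx xc] j /=; rewrite !mxE; case: eqVneq => [->|_]; last exact: Qx.
  by have /andP[-> h] := Qx i; rewrite le_min h andbT.
apply: le_trans (outer_box_le _); apply: le_outer_measure.
move=> x [Qx /negP xc] j /=; rewrite !mxE; case: eqVneq => [->|_]; last exact: Qx.
by have /andP[h ->] := Qx i; rewrite gt_max h !andbT ltNge.
Qed.

Lemma box_measurable Q : lebesgue_measurable (box Q).
Proof.
have -> : box Q = \bigcap_(i in [set: 'I_d])
    (~` halfspace i (Q.1 0 i) `&` halfspace i (Q.2 0 i)).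
  apply/seteqP; split=> x.
    move=> Qx i _; have /andP[h1 h2] := Qx i; split=> //=.
    by apply/negP; rewrite -ltNge.
  by move=> Qx i; have [/negP h1 h2] := Qx i I; rewrite ltNge h1.
rewrite /lebesgue_measurable.
apply: (@fin_bigcap_measurable _ (lebesgue_space R d)) => // i _.
apply: (@measurableI _ (lebesgue_space R d)); last exact: halfspace_measurable.
by apply: (@measurableC _ (lebesgue_space R d)); exact: halfspace_measurable.
Qed.

Lemma coord_measurable i :
  measurable_fun [set: lebesgue_space R d] (fun x : lebesgue_space R d => (x : 'rV[R]_d) 0 i).
Proof.
apply: (measurability _ (RGenOInfty.measurableE R)) => _ [_ [r ->] <-].
have -> : [set: lebesgue_space R d] `&` (fun x => x 0 i) @^-1` `]r, +oo[%classic
   = ~` halfspace i r.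
  apply/seteqP; split=> x /=; rewrite in_itv/= andbT.
    by move=> [_ h]; apply/negP; rewrite -ltNge.
  by move=> /negP; rewrite -ltNge => h; split.
by apply: (@measurableC _ (lebesgue_space R d)); exact: halfspace_measurable.
Qed.

End lebesgue_boxes.

(** * Lower bound for the total volume of a countable cover by boxes *)

Section volume_lower_bound.
Variable R : realType.
Local Open Scope ereal_scope.

Let ind (a b t : R) : R := ((a < t) && (t <= b))%R%:R.

Let integral_ind (a b : R) :
  \int[@lebesgue_measure R]_t (ind a b t)%:E = (Num.max 0 (b - a))%R%:E.
Proof.
have -> : (fun t : R => (ind a b t)%:E) = (fun t => (\1_`]a, b]%classic t)%:E).
  by apply/funext => t; rewrite indicE mem_setE in_itv.
rewrite integral_indic// setIT; transitivity (lebesgue_measure `]a, b]%classic) => //.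
rewrite lebesgue_measure_itv/= lte_fin.
case: ltP => ab; first by rewrite -EFinB; congr EFin; rewrite maxEle subr_ge0 ltW.
by congr EFin; rewrite maxEle subr_ge0; case: ifPn => // h; lra.
Qed.

Let measurable_ind (a b : R) :
  measurable_fun [set: measurableTypeR R] (fun t : R => ind a b t).
Proof.
have -> : (fun t : R => ind a b t) = \1_`]a, b]%classic :> (R -> R).
  by apply/funext => t; rewrite indicE mem_setE in_itv.
exact: measurable_indic.
Qed.

Let prod_ind_ge0 d (a b x : nat -> R) :
  (0 <= \prod_(j < d) ind (a j) (b j) (x j))%R.
Proof. by apply: prodr_ge0 => j _; rewrite /ind; case: (_ && _). Qed.

(* Integrate the inequality between indicators one coordinate at a time. *)
Lemma volume_le_series (d : nat) (c : R) (a b : nat -> R)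
    (w : nat -> R) (A B : nat -> nat -> R) :
  (0 <= c)%R -> (forall i, 0 <= w i)%R ->
  (forall x : nat -> R,
    (c * \prod_(j < d) ((a j < x j) && (x j <= b j))%R%:R)%:E <=
    \sum_(i <oo) (w i * \prod_(j < d)
      ((A i j < x j) && (x j <= B i j))%R%:R)%:E) ->
  (c * \prod_(j < d) Num.max 0%R (b j - a j))%:E <=
  \sum_(i <oo) (w i * \prod_(j < d) Num.max 0%R (B i j - A i j))%:E.
Proof.
elim: d c w => [|d IH] c w c0 w0 H.
  have e (F : nat -> 'I_0 -> R) : \sum_(i <oo) (w i * \prod_(j < 0) F i j)%:E =
      \sum_(i <oo) (w i)%:E.
    by apply: eq_eseriesr => i _; rewrite big_ord0 mulr1.
  by have := H (fun=> 0%R); rewrite !e !big_ord0.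
have m0 (u : R) : (0 <= Num.max 0 u)%R by rewrite le_max lexx.
(* The last side lengths move into the weights [c] and [w i], which is why these are arbitrary
   nonnegative numbers. *)
rewrite big_ord_recr/= mulrCA mulrC -mulrA mulrCA mulrA.
under eq_eseriesr do rewrite big_ord_recr/= mulrCA mulrC -mulrA mulrCA mulrA.
apply: IH => [|i|x]; [exact: mulr_ge0|exact: mulr_ge0|].
pose y t := fun j => if j == d then t else x j.
have yE (a' b' : nat -> R) t : (\prod_(j < d.+1) ind (a' j) (b' j) (y t j) =
    \prod_(j < d) ind (a' j) (b' j) (x j) * ind (a' d) (b' d) t)%R.
  rewrite big_ord_recr/= {2}/y eqxx; congr (_ * _)%R; apply: eq_bigr => j _.
  by rewrite /y ltn_eqF.
pose p := (\prod_(j < d) ind (a j) (b j) (x j))%R.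
pose q i := (\prod_(j < d) ind (A i j) (B i j) (x j))%R.
have intE (k u v : R) : (0 <= k)%R ->
  \int[@lebesgue_measure R]_t (k * ind u v t)%:E = (k * Num.max 0%R (v - u))%:E.
  move=> k0; under eq_integral do rewrite EFinM.
  rewrite ge0_integralZl_EFin//.
  - by rewrite integral_ind EFinM.
  - by move=> t _; rewrite lee_fin /ind; case: (_ && _).
  - by apply/measurable_EFinP; exact: measurable_ind.
have -> : (Num.max 0 (b d - a d) * c * \prod_(j < d) (a j < x j <= b j)%R%:R =
  (c * p) * Num.max 0 (b d - a d))%R by rewrite -mulrA mulrC.
have E i : (Num.max 0 (B i d - A i d) * w i *
    \prod_(j < d) (A i j < x j <= B i j)%R%:R)%:E =
  \int[@lebesgue_measure R]_t (w i * q i * ind (A i d) (B i d) t)%:E.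
  by rewrite intE ?mulr_ge0 ?prod_ind_ge0// -mulrA mulrC.
under eq_eseriesr do rewrite E.
rewrite -intE ?mulr_ge0 ?prod_ind_ge0// -integral_nneseries//=; last 2 first.
- move=> i; apply/measurable_EFinP; apply: measurable_funM => //; exact: measurable_ind.
- by move=> i t _; rewrite lee_fin !mulr_ge0 ?prod_ind_ge0// /ind; case: (_ && _).
apply: ge0_le_integral => //=.
- by move=> t _; rewrite lee_fin !mulr_ge0 ?prod_ind_ge0// /ind; case: (_ && _).
- apply/measurable_EFinP; apply: measurable_funM => //; exact: measurable_ind.
- apply: ge0_emeasurable_sum => [i t _ _|i _].
    by rewrite lee_fin !mulr_ge0 ?prod_ind_ge0// /ind; case: (_ && _).
  apply/measurable_EFinP; apply: measurable_funM => //; exact: measurable_ind.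
move=> t _; have := H (y t); rewrite -/(ind _ _ _) yE mulrA.
move=> /le_trans; apply; rewrite le_eqVlt; apply/orP; left; apply/eqP.
by apply: eq_eseriesr => i _; rewrite -mulrA -yE.
Qed.

End volume_lower_bound.

Lemma lipschitz_continuous (R : realType) (V W : normedModType R) (f : V -> W) (C : R) :
  (forall x y, `|f x - f y| <= C * `|x - y|) -> continuous f.
Proof.
move=> fC x; apply/(@cvgrPdist_lt _ _ _ (nbhs x)) => e e0.
have C0 : 0 < `|C| + 1 by rewrite ltr_wpDl.
near=> y; apply: le_lt_trans (fC _ _) _.
apply: (@le_lt_trans _ _ ((`|C| + 1) * `|x - y|)).
  by rewrite ler_wpM2r// (le_trans (ler_norm _))// lerDl.
rewrite mulrC -ltr_pdivlMr//.
by near: y; apply/nbhs_normP; exists (e / (`|C| + 1)) => //=; exact: divr_gt0.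
Unshelve. all: by end_near. Qed.

Lemma norm_subr_lip (R : realType) (V : normedModType R) (q x y : V) :
  `| `|q - x| - `|q - y| | <= `|x - y|.
Proof.
apply: le_trans (ler_dist_dist _ _) _.
by rewrite opprB addrC addrA subrK distrC.
Qed.

(** * Lebesgue measure of boxes, translates and open sets *)

Section lebesgue_measure_space.
Variables (R : realType) (d : nat).
Local Notation mu := (@lebesgue_outer R d).
Local Notation space := (lebesgue_space R d).
Implicit Types (A B U : set 'rV[R]_d) (Q : 'rV[R]_d * 'rV[R]_d).

Lemma rV_norm_le (x : 'rV[R]_d) (r : R) : 0 <= r ->
  (`|x| <= r) <-> (forall i, `|x 0 i| <= r).
Proof.
move=> r0; rewrite /Num.norm/= mx_normrE; split=> [H i|H].
  by apply: le_trans H; exact: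
    (le_bigmax_cond _ (fun ij : 'I_1 * 'I_d => `|x ij.1 ij.2|) (j := (0, i))).
by apply: bigmax_le => // -[j i] _ /=; rewrite (ord1 j); exact: H.
Qed.

Lemma rV_coord_le (x : 'rV[R]_d) i : `|x 0 i| <= `|x|.
Proof. exact: (rV_norm_le x (normr_ge0 x)).1. Qed.

(** The indicator of Q is at most the sum of the indicators of the boxes of a cover, and
    [volume_le_series] turns this into an inequality between volumes. *)
Lemma lebesgue_box Q : mu (box Q) = (box_volume Q)%:E.
Proof.
apply/eqP; rewrite eq_le outer_box_le/=.
apply: le_ereal_inf_tmp => _ [C [cC AC] <-].
have [g [P [CE ->]]] := countable_enum R cC; last first.
  by move=> Q'; rewrite lee_fin box_volume_ge0.
(* Rows are prolonged by 0 to sequences, the form in which [volume_le_series] can induct on the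
   dimension. *)
pose ext (u : 'rV[R]_d) (j : nat) := if insub j is Some i then u 0 i else 0.
have extE u (i : 'I_d) : ext u i = u 0 i by rewrite /ext valK.
pose w i : R := (i \in P)%:R.
have := @volume_le_series R d 1 (ext Q.1) (ext Q.2) w
  (fun i => ext (g i).1) (fun i => ext (g i).2) ler01.
have volE Q' : \prod_(j < d) Num.max 0 (ext Q'.2 j - ext Q'.1 j) = box_volume Q'.
  by apply: eq_bigr => i _; rewrite !extE.
rewrite mul1r volE.
have -> : (\sum_(i <oo) (w i * \prod_(j < d)
    Num.max 0 (ext (g i).2 j - ext (g i).1 j))%:E =
  \sum_(i <oo) (if i \in P then (box_volume (g i))%:E else 0))%E.
  apply: eq_eseriesr => i _; rewrite volE /w.
  by case: (i \in P); rewrite ?mul1r ?mul0r.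
apply=> [i|x]; first by rewrite /w ler0n.
pose X : 'rV[R]_d := \row_(j < d) x j.
have indE Q' : \prod_(j < d) (ext Q'.1 j < x j <= ext Q'.2 j)%R%:R
    = (`[< box Q' X >])%:R :> R.
  case: asboolP => [QX|].
    by rewrite big1// => i _; have := QX i; rewrite !extE !mxE => ->.
  rewrite -existsNE => -[i] /negP QX; apply/eqP/prodf_eq0; exists i => //.
  by move: QX; rewrite !extE !mxE => /negPf ->.
have t0 i : (0 <= (w i * \prod_(j < d)
     (ext (g i).1 j < x j <= ext (g i).2 j)%R%:R)%:E)%E.
  by rewrite lee_fin indE mulr_ge0// ler0n.
rewrite mul1r indE; case: asboolP => [QX|_]; last first.
  by apply: nneseries_ge0 => i _ _.
have [Q'] := AC _ QX; rewrite {1}CE => -[k Pk <-] gX.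
rewrite (@nneseriesD1 _ _ k)//= indE asboolT// mulr1 /w mem_set//.
by apply: leeDl; apply: nneseries_ge0 => i _ _; exact: t0.
Qed.

Lemma outer_shift_le A (c : 'rV[R]_d) : (mu [set (x + c)%R | x in A] <= mu A)%E.
Proof.
apply: le_ereal_inf_tmp => _ [C [cC AC] <-].
pose sh (Q : 'rV[R]_d * 'rV[R]_d) := (Q.1 + c, Q.2 + c).
have volE Q : box_volume (sh Q) = box_volume Q.
  by apply: eq_bigr => i _; rewrite !mxE; congr (Num.max _ _); ring.
have sh_inj : set_inj C sh.
  by move=> [a b] [a' b'] _ _ [/addIr -> /addIr ->].
have csh : countable (sh @` C).
  by apply: sub_countable cC; exact: card_image_le.
apply: (le_trans (outer_le_cover csh _)) => [_ [x /AC [Q CQ Qx] <-]|].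
  exists (sh Q); first by exists Q.
  by move=> i /=; rewrite !mxE lerD2r ltrD2r; exact: Qx.
by rewrite esum_image// le_eqVlt (eq_esum (fun Q _ => congr1 EFin (volE Q))) eqxx.
Qed.

Lemma outer_shift A (c : 'rV[R]_d) : mu [set (x + c)%R | x in A] = mu A.
Proof.
apply/eqP; rewrite eq_le outer_shift_le/=.
have {1}-> : A = [set x + - c | x in [set x + c | x in A]].
  rewrite image_comp -[LHS]image_id; apply: eq_imagel => x _ /=.
  by rewrite addrK.
exact: outer_shift_le.
Qed.

(** An open set is the union of the countably many boxes with rational corners that it contains. *)
Lemma open_lebesgue_measurable U : open U -> lebesgue_measurable U.
Proof.
move=> oU.
pose bx (q : 'rV[rat]_d * 'rV[rat]_d) : set 'rV[R]_d :=
  box (map_mx ratr q.1, map_mx ratr q.2).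
pose F q := if `[< bx q `<=` U >] then bx q else set0.
have -> : U = \bigcup_q F q.
  apply/seteqP; split=> [x Ux|x [q _]]; last first.
    by rewrite /F; case: asboolP => // /(_ x).
  have /nbhs_ballP [e /= e0 xeU] : nbhs x U by exact: open_nbhs_nbhs.
  have H1 (i : 'I_d) : exists q : rat, x 0 i - e / 2 < ratr q < x 0 i.
    have [|q] := @rat_in_itvoo R (x 0 i - e / 2) (x 0 i); first by lra.
    by rewrite in_itv => ?; exists q.
  have H2 (i : 'I_d) : exists q : rat, x 0 i < ratr q < x 0 i + e / 2.
    have [|q] := @rat_in_itvoo R (x 0 i) (x 0 i + e / 2); first by lra.
    by rewrite in_itv => ?; exists q.
  have [p Hp] := choice H1; have [q Hq] := choice H2.
  exists (\row_i p i, \row_i q i) => //; rewrite /F asboolT.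
    by move=> i /=; rewrite !mxE; have := Hp i; have := Hq i; lra.
  move=> y yb; apply: xeU; rewrite mx_norm_ball /ball_/=.
  apply: (@le_lt_trans _ _ (e / 2)); last by lra.
  apply/rV_norm_le; first lra.
  move=> i; have := yb i; have := Hp i; have := Hq i; rewrite !mxE ler_norml.
  by lra.
apply: (@countable_bigcupT_measurable _ space) => [|q]; first exact: countableP.
rewrite /F; case: asboolP => _; first exact: box_measurable.
exact: (@measurable0 _ space).
Qed.

Lemma continuous_lebesgue_measurable (f : 'rV[R]_d -> R) :
  continuous f -> measurable_fun [set: space] (f : space -> R).
Proof.
move=> /continuousP cf; apply: (measurability _ (RGenOpens.measurableE R)).
move=> _ [_ [a [b ->] <-]]; rewrite setTI; apply: open_lebesgue_measurable.
exact/cf/interval_open.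
Qed.

(** A sup-norm ball in half-open form, so that it is a [box]; it lies between the open and the
    closed ball. *)
Definition cube (X : 'rV[R]_d) (r : R) : set 'rV[R]_d :=
  box (X - const_mx r, X + const_mx r).

Lemma cube_norm X r Y : 0 <= r -> cube X r Y -> `|X - Y| <= r.
Proof.
move=> r0 h; apply/rV_norm_le => // i; have := h i; rewrite !mxE ler_norml; lra.
Qed.

Lemma norm_cube X r Y : `|X - Y| < r -> cube X r Y.
Proof.
move=> h i; have := le_lt_trans (rV_coord_le (X - Y) i) h.
by rewrite !mxE ltr_norml; lra.
Qed.

Lemma cube_measurable X r : lebesgue_measurable (cube X r).
Proof. exact: box_measurable. Qed.

Lemma lebesgue_cube X r : 0 <= r -> mu (cube X r) = ((2 * r) ^+ d)%:E.
Proof.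
move=> r0; rewrite lebesgue_box /box_volume /=; congr EFin.
rewrite (eq_bigr (fun=> 2 * r)) ?prodr_const ?card_ord// => i _; rewrite !mxE.
by rewrite max_r; lra.
Qed.

Lemma lebesgue_sigma_finite :
  sigma_finite [set: space] (lebesgue R d).
Proof.
exists (fun k => cube 0 k%:R) => [|k].
  apply/seteqP; split=> // X _; exists (Num.bound `|X|) => //.
  by apply: norm_cube; rewrite sub0r normrN archi_boundP.
split; first exact: cube_measurable.
by rewrite lebesgue_cube// ltry.
Qed.

(* Registering the Caratheodory measure directly on [lebesgue_outer] lets it
   be extended with sigma-finiteness, which Tonelli's theorem requires. *)
Let lebesgue0 : lebesgue R d set0 = 0.
Proof. exact: outer_measure0. Qed.

Let lebesgue_ge0 (A : set space) : (0 <= lebesgue R d A)%E.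
Proof. exact: outer_measure_ge0. Qed.

Let lebesgue_sigma_additive : semi_sigma_additive (lebesgue R d).
Proof. exact: caratheodory_measure_sigma_additive. Qed.

HB.instance Definition _ := isMeasure.Build _ space R (lebesgue R d)
  lebesgue0 lebesgue_ge0 lebesgue_sigma_additive.
HB.instance Definition _ := Measure_isSigmaFinite.Build _ space R
  (lebesgue R d) lebesgue_sigma_finite.

End lebesgue_measure_space.

(** * Interactions and minimality *)

Lemma nneseries_geometric_le (R : realType) (a z : R) :
  0 <= a -> 0 < z -> z < 1 ->
  (\sum_(j <oo) (a * z ^+ j)%:E <= (a / (1 - z))%:E)%E.
Proof.
move=> a0 z0 z1; apply: lime_le.
  by apply: is_cvg_nneseries => j _ _; rewrite lee_fin mulr_ge0// exprn_ge0// ltW.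
apply: nearW => N; rewrite sumEFin lee_fin.
apply: le_trans (geometric_le_lim N a0 z0 _); last by rewrite gtr0_norm.
by rewrite /series/= le_eqVlt eqxx.
Qed.

(** The letters are the interactions in the perimeters of E and of a competitor. Only the former
    perimeter is known to be finite, so [z] and [w] may be infinite. *)
Lemma cancel_finite (R : realType) (a b c x y z w : \bar R) :
  (0 <= a)%E -> (0 <= b)%E -> (0 <= c)%E -> (0 <= x)%E -> (0 <= y)%E ->
  (0 <= z)%E -> (0 <= w)%E -> (a + x + (b + y) + c < +oo)%E ->
  (a + x + (b + y) + c <= a + z + b + (c + w))%E -> (x + y <= z + w)%E.
Proof.
move=> a0 b0 c0 x0 y0 z0 w0 P; move: (P).
have fin (u v : \bar R) : (0 <= u)%E -> (0 <= v)%E -> (u + v < +oo)%E ->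
    u \is a fin_num /\ v \is a fin_num.
  move=> u0 v0 uv; split; rewrite ge0_fin_numE//; apply: le_lt_trans uv.
    exact: leeDl.
  exact: leeDr.
have [h1 /fineK <-] := fin _ _ (adde_ge0 (adde_ge0 a0 x0) (adde_ge0 b0 y0)) c0 P.
move: h1; rewrite ge0_fin_numE ?adde_ge0// => h1.
have [h2 h3] := fin _ _ (adde_ge0 a0 x0) (adde_ge0 b0 y0) h1.
move: h2 h3; rewrite !ge0_fin_numE ?adde_ge0// => h2 h3.
have [/fineK <- /fineK <-] := fin _ _ a0 x0 h2.
have [/fineK <- /fineK <-] := fin _ _ b0 y0 h3.
case: z z0 => [z| |]// _; last by move: w w0 => [w| |]//= _ _; rewrite ?addye ?leey.
case: w w0 => [w| |]// _; last by rewrite ?addey ?leey.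
by rewrite -!EFinD !lee_fin; lra.
Qed.

Section interactions.
Variables (R : realType) (d : nat) (s : R).
Hypotheses (d_gt0 : (0 < d)%N) (s_gt0 : 0 < s).
Local Notation mu := (@lebesgue_outer R d).
Local Notation space := (lebesgue_space R d).
Implicit Types (A B E U : set 'rV[R]_d) (X Y : 'rV[R]_d).

Definition kernel X Y : R := (enorm (X - Y) `^ (d%:R + s))^-1.

Let expo_gt0 : 0 < d%:R + s.
Proof. by rewrite ltr_wpDl// ler0n. Qed.

Lemma norm_le_enorm X : `|X| <= enorm X.
Proof.
apply/rV_norm_le; first exact: sqrtr_ge0.
move=> i; rewrite -sqrtr_sqr ler_sqrt ?sumr_ge0//; last by move=> *; exact: sqr_ge0.
by rewrite (bigD1 i)//= lerDl sumr_ge0// => *; exact: sqr_ge0.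
Qed.

Lemma enorm_le_norm X : enorm X <= Num.sqrt d%:R * `|X|.
Proof.
rewrite -[`|X|]ger0_norm// -sqrtr_sqr -sqrtrM// ler_sqrt; last first.
  by rewrite mulr_ge0// sqr_ge0.
rewrite -[d in d%:R]card_ord -sum1_card natr_sum mulr_suml; apply: ler_sum => i _.
by rewrite mul1r -real_normK ?num_real// ler_sqr ?nnegrE//; exact: rV_coord_le.
Qed.

Lemma kernel_ge0 X Y : 0 <= kernel X Y.
Proof. by rewrite invr_ge0 powR_ge0. Qed.

Lemma kernelC X Y : kernel X Y = kernel Y X.
Proof.
rewrite /kernel; congr (_ `^ _)^-1; rewrite /enorm; congr Num.sqrt.
by apply: eq_bigr => i _; rewrite !mxE -sqrrN opprB.
Qed.

Lemma kernel_le X Y r : 0 < r -> r <= `|X - Y| ->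
  kernel X Y <= (r `^ (d%:R + s))^-1.
Proof.
move=> r0 rXY; have re := le_trans rXY (norm_le_enorm _).
rewrite /kernel lef_pV2 ?posrE ?powR_gt0//; last exact: lt_le_trans re.
by apply: ge0_ler_powR; rewrite ?nnegrE ?(ltW expo_gt0)// ?ltW//; exact: lt_le_trans re.
Qed.

(** On the diagonal the kernel has the default value 0, so the points must be distinct; the square
    root compares the Euclidean norm with the sup norm. *)
Lemma kernel_ge X Y r : X != Y -> `|X - Y| <= r ->
  ((Num.sqrt d%:R * r) `^ (d%:R + s))^-1 <= kernel X Y.
Proof.
move=> XY XYr.
have XY0 : 0 < `|X - Y| by rewrite normr_gt0 subr_eq0.
have sd0 : 0 < Num.sqrt d%:R :> R by rewrite sqrtr_gt0 ltr0n.
have e0 := lt_le_trans XY0 (norm_le_enorm _).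
have r0 := lt_le_trans XY0 XYr.
rewrite /kernel lef_pV2 ?posrE ?powR_gt0//; last exact: mulr_gt0.
apply: ge0_ler_powR; rewrite ?nnegrE ?(ltW expo_gt0)//.
- exact: ltW.
- by rewrite mulr_ge0// ltW.
- by apply: le_trans (enorm_le_norm _) _; rewrite ler_pM2l.
Qed.

Lemma kernel_measurable :
  measurable_fun [set: space * space] (fun p => kernel p.1 p.2).
Proof.
have -> : (fun p : space * space => kernel p.1 p.2) = fun p : space * space =>
    (((\sum_(i < d) ((p.1 : 'rV[R]_d) 0 i - (p.2 : 'rV[R]_d) 0 i) ^+ 2) `^ 2^-1)
      `^ (- (d%:R + s))).
  apply/funext => p; rewrite /kernel powRN /enorm; congr (_ `^ _)^-1.
  rewrite powR12_sqrt; last by apply: sumr_ge0 => *; exact: sqr_ge0.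
  by congr Num.sqrt; apply: eq_bigr => i _; rewrite !mxE.
apply: (measurableT_comp (measurable_powR _)).
apply: (measurableT_comp (measurable_powR _)).
apply: measurable_sum => i; apply: measurable_funX; apply: measurable_funB.
  exact: (measurableT_comp (coord_measurable i) measurable_fst).
exact: (measurableT_comp (coord_measurable i) measurable_snd).
Qed.

Lemma ekernel_measurable (D : set space) X : measurable D ->
  measurable_fun D (fun Y : space => (kernel X Y)%:E).
Proof.
move=> mD; apply/measurable_funTS/measurable_EFinP.
exact: (measurable_fun_pair2 (X : space) kernel_measurable).
Qed.

Definition potential B X : \bar R := (\int[lebesgue R d]_(Y in B) (kernel X Y)%:E)%E.

Lemma interactionE A B :
  interaction s A B = (\int[lebesgue R d]_(X in A) potential B X)%E.
Proof. by []. Qed.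

Lemma potential_ge0 B X : (0 <= potential B X)%E.
Proof. by apply: integral_ge0 => Y _; rewrite lee_fin kernel_ge0. Qed.

Lemma interaction_ge0 A B : (0 <= interaction s A B)%E.
Proof. by apply: integral_ge0 => X _; exact: potential_ge0. Qed.

Let kind A B (p : space * space) : \bar R :=
  (kernel p.1 p.2 * \1_A p.1 * \1_B p.2)%:E.

Let kind_measurable A B : lebesgue_measurable A -> lebesgue_measurable B ->
  measurable_fun setT (kind A B).
Proof.
move=> mA mB; apply/measurable_EFinP; apply: measurable_funM; [apply: measurable_funM|].
- exact: kernel_measurable.
- by apply: (measurableT_comp _ measurable_fst); exact: measurable_indic.
- by apply: (measurableT_comp _ measurable_snd); exact: measurable_indic.
Qed.

Let kind_ge0 A B p : (0 <= kind A B p)%E.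
Proof. by rewrite lee_fin !mulr_ge0 ?kernel_ge0// indicE ler0n. Qed.

Lemma potential_measurable B (D : set space) : lebesgue_measurable B ->
  measurable D -> measurable_fun D (potential B).
Proof.
move=> mB mD; apply: measurable_funTS.
have -> : potential B = fubini_F (lebesgue R d) (kind setT B).
  apply/funext => X; rewrite /potential /fubini_F [LHS]integral_mkcond.
  apply: eq_integral => Y _; rewrite patchE /kind/= !indicE in_setT mulr1.
  by case: (Y \in B); rewrite ?mulr1 ?mulr0.
by apply: measurable_fun_fubini_tonelli_F => //; exact: kind_measurable (@measurableT _ space) _.
Qed.

(** Tonelli's theorem and the symmetry of the kernel; indicator weights replace integration over A
    and B by integration over the whole product. *)
Lemma interactionC A B : lebesgue_measurable A -> lebesgue_measurable B ->
  interaction s A B = interaction s B A.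
Proof.
move=> mA mB; rewrite !interactionE.
have E C D : (\int[lebesgue R d]_(X in C) potential D X =
    \int[lebesgue R d]_X \int[lebesgue R d]_Y kind C D (X, Y))%E.
  rewrite [LHS]integral_mkcond; apply: eq_integral => X _; rewrite patchE.
  case: ifPn => [XC|/negPf XC]; last first.
    by rewrite integral0_eq// => Y _; rewrite /kind indicE XC mulr0 mul0r.
  rewrite /potential [LHS]integral_mkcond; apply: eq_integral => Y _; rewrite patchE.
  by rewrite /kind/= !indicE XC mulr1; case: (Y \in D); rewrite ?mulr1 ?mulr0.
rewrite E (fubini_tonelli (kind A B) (kind_measurable mA mB) (kind_ge0 A B)).
rewrite E; apply: eq_integral => X _; apply: eq_integral => Y _.
by rewrite /kind/= kernelC mulrAC.
Qed.

Lemma interactionUl A1 A2 B : lebesgue_measurable A1 -> lebesgue_measurable A2 ->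
  lebesgue_measurable B -> A1 `&` A2 = set0 ->
  (interaction s (A1 `|` A2) B = interaction s A1 B + interaction s A2 B)%E.
Proof.
move=> mA1 mA2 mB A12; rewrite !interactionE ge0_integral_setU//.
- by apply: potential_measurable => //; exact: measurableU.
- by move=> X _; exact: potential_ge0.
- by apply/eqP.
Qed.

Lemma interactionUr A B1 B2 : lebesgue_measurable A -> lebesgue_measurable B1 ->
  lebesgue_measurable B2 -> B1 `&` B2 = set0 ->
  (interaction s A (B1 `|` B2) = interaction s A B1 + interaction s A B2)%E.
Proof.
move=> mA mB1 mB2 B12; rewrite (interactionC mA (measurableU _ _ mB1 mB2)).
rewrite (interactionUl mB1 mB2 mA B12).
by rewrite (interactionC mB1 mA) (interactionC mB2 mA).
Qed.

Lemma le_interaction A A' B B' : lebesgue_measurable A -> lebesgue_measurable A' ->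
  lebesgue_measurable B -> lebesgue_measurable B' ->
  A `<=` A' -> B `<=` B' -> (interaction s A B <= interaction s A' B')%E.
Proof.
move=> mA mA' mB mB' AA BB; rewrite !interactionE.
apply: (@le_trans _ _ (\int[lebesgue R d]_(X in A') potential B X)%E).
  apply: ge0_subset_integral => //; first exact: potential_measurable.
  by move=> X _; exact: potential_ge0.
apply: ge0_le_integral => //; try by move=> *; exact: potential_ge0.
- exact: potential_measurable.
- exact: potential_measurable.
move=> X _; apply: (ge0_subset_integral (lebesgue R d) mB mB' _ _ BB).
  exact: ekernel_measurable.
by move=> Y _; rewrite lee_fin kernel_ge0.
Qed.

Lemma interaction_le A B (c : \bar R) : lebesgue_measurable A ->
  lebesgue_measurable B -> (0 <= c)%E ->
  (forall X, A X -> (potential B X <= c)%E) -> (interaction s A B <= c * mu A)%E.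
Proof.
move=> mA mB c0 H; rewrite interactionE -(integral_cst (lebesgue R d))//.
apply: ge0_le_integral => //; first by move=> *; exact: potential_ge0.
exact: potential_measurable.
Qed.

Lemma interaction_ge A B (c : \bar R) : lebesgue_measurable A ->
  lebesgue_measurable B -> (0 <= c)%E ->
  (forall X, A X -> (c <= potential B X)%E) -> (c * mu A <= interaction s A B)%E.
Proof.
move=> mA mB c0 H; rewrite interactionE -(integral_cst (lebesgue R d))//.
apply: ge0_le_integral => //; exact: potential_measurable.
Qed.

Lemma interaction_null A B : lebesgue_measurable A -> lebesgue_measurable B ->
  mu A = 0 -> interaction s A B = 0.
Proof.
by move=> mA mB A0; rewrite interactionE null_set_integral//; exact: potential_measurable.
Qed.

(* The competitor is E \ A. *)
Lemma minimal_comparison E U A : lebesgue_measurable E -> lebesgue_measurable U ->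
  lebesgue_measurable A -> A `<=` E `&` U -> minimal s E U ->
  (interaction s A (~` E) <= interaction s (E `\` A) A)%E.
Proof.
move=> mE mU mA AEU [Pfin Pmin].
have mC B : lebesgue_measurable B -> lebesgue_measurable (~` B).
  by move=> ?; exact: measurableC.
have mI B C : lebesgue_measurable B -> lebesgue_measurable C ->
    lebesgue_measurable (B `&` C) by move=> ? ?; exact: measurableI.
have mD B C : lebesgue_measurable B -> lebesgue_measurable C ->
    lebesgue_measurable (B `\` C) by move=> ? ?; exact: measurableD.
have := Pmin (E `\` A) (mD _ _ mE mA).
have e5 : (E `\` A) `\` U = E `\` U.
  by apply/seteqP; split=> X [] /= => [[]//|EX UX]; split=> //; split=> // /AEU [].
have ae_refl B : eqset_ae B B by apply: aeW => X.
rewrite e5 => /(_ (ae_refl _)).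
(* Passing to the competitor keeps [EU] and moves A to the complement, so both perimeters split into
   interactions between [EU], A, [E \ U] and the two parts of the complement of E. *)
pose EU := (E `&` U) `\` A.
have e1 : E `&` U = EU `|` A.
  rewrite /EU; apply/seteqP; split=> X; last by move=> [[]//|/AEU].
  by move=> EUX; have [AX|AX] := pselect (A X); [right|left].
have e2 : (E `\` A) `&` U = EU by apply/seteqP; split=> X /=; rewrite /EU /setD/=; tauto.
have e3 : ~` (E `\` A) `&` U = (~` E `&` U) `|` A.
  rewrite setCD; apply/seteqP; split=> X /=; first by tauto.
  by move=> [|AX]; [tauto|have [] := AEU _ AX; tauto].
have e4 : ~` (E `\` A) `\` U = ~` E `\` U.
  rewrite setCD; apply/seteqP; split=> X /=; last by tauto.
  by move=> [[|/AEU[]]].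
move: Pfin; rewrite /perimeter e2 e3 e4 e5 e1.
have EUA : EU `&` A = set0 by apply/seteqP; split=> // X [[_]].
have EcA : (~` E `&` U) `&` A = set0.
  by apply/seteqP; split=> // X [[EX _] /AEU []].
have EcUU : (~` E `&` U) `&` (~` E `\` U) = set0.
  by apply/seteqP; split=> // X [[_ UX] []].
have EUU : EU `&` (E `\` U) = set0.
  by apply/seteqP; split=> // X [[[_ UX] _] []].
have mEU : lebesgue_measurable EU by rewrite /EU; auto.
have mE' := mC _ mE.
have m1 := mI _ _ mE' mU; have m2 := mD _ _ mE' mU; have m3 := mD _ _ mE mU.
rewrite (interactionUl mEU mA m1 EUA) (interactionUl mEU mA m2 EUA).
rewrite (interactionUr mEU m1 mA EcA) (interactionUr m3 m1 mA EcA).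
have -> : E `\` A = EU `|` (E `\` U).
  rewrite /EU; apply/seteqP; split=> X /=.
    by move=> [EX AX]; have [UX|UX] := pselect (U X); [left|right].
  by move=> [[[]]//|[EX UX]]; split=> // /AEU[].
have := interactionUr mA m1 m2 EcUU; rewrite setUIDK => ->.
rewrite (interactionUl mEU m3 mA EUU).
by apply: cancel_finite; apply: interaction_ge0.
Qed.

End interactions.

(** * Dyadic upper bound and isoperimetric lower bound *)

Section kernel_estimates.
Variables (R : realType) (d : nat) (s : R).
Hypotheses (d_gt0 : (0 < d)%N) (s_gt0 : 0 < s).
Local Notation mu := (@lebesgue_outer R d).
Local Notation space := (lebesgue_space R d).
Implicit Types (A B E U : set 'rV[R]_d) (X Y : 'rV[R]_d).

Let pow_split (x : R) : 0 < x -> x `^ (d%:R + s) = x ^+ d * x `^ s.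
Proof.
move=> x0; rewrite powRD ?powR_mulrn ?ltW//.
by apply/implyP => _; rewrite gt_eqF.
Qed.

Let pow2_gt0 j : 0 < 2 ^+ j :> R.
Proof. exact: exprn_gt0. Qed.

Let z : R := 2 `^ (- s).

Let z_gt0 : 0 < z.
Proof. exact: powR_gt0. Qed.

Let z_lt1 : z < 1.
Proof.
rewrite /z powRN invf_lt1 ?powR_gt0//.
rewrite -[X in X < _](powRr0 (2 : R)).
by rewrite /powR pnatr_eq0/= mul0r ltr_expR mulr_gt0// ln_gt0// ltr1n.
Qed.

Definition far_const : R := 4 ^+ d / (1 - z).

Lemma far_const_gt0 : 0 < far_const.
Proof. by rewrite /far_const divr_gt0 ?exprn_gt0// subr_gt0. Qed.

(** Between the cubes of radii 2^j r and 2^(j+1) r the kernel is at most (2^j r)^(-(d+s)), and the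
    larger cube has volume 4^d (2^j r)^d. The products form a geometric series of ratio 2^(-s),
    whence [far_const]. *)
Lemma potential_far X r : 0 < r ->
  (potential s (~` cube X r) X <= (far_const * r `^ (- s))%:E)%E.
Proof.
move=> r0.
have rj0 j : 0 < 2 ^+ j * r by rewrite mulr_gt0.
pose t j (Y : space) : \bar R :=
  (((2 ^+ j * r) `^ (d%:R + s))^-1 * \1_(cube X (2 ^+ j.+1 * r)) Y)%:E.
have t0 j Y : (0 <= t j Y)%E.
  by rewrite lee_fin mulr_ge0 ?invr_ge0 ?powR_ge0// indicE ler0n.
have mt j : measurable_fun setT (t j).
  apply/measurable_EFinP; apply: measurable_funM; first exact: measurable_cst.
  by apply: measurable_indic; exact: cube_measurable.
have mts : measurable_fun [set: space] (fun Y => \sum_(j <oo) t j Y)%E.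
  by apply: ge0_emeasurable_sum => [j Y _ _|j _]; [exact: t0|exact: mt].
have mcube : lebesgue_measurable (~` cube X r).
  by apply: measurableC; exact: cube_measurable.
have pointwise Y : (~` cube X r) Y -> ((kernel s X Y)%:E <= \sum_(j <oo) t j Y)%E.
  move=> XY.
  have [N XYN] : exists N, cube X (2 ^+ N * r) Y.
    exists (Num.bound (`|X - Y| / r)); apply: norm_cube.
    by rewrite -ltr_pdivrMr// upper_nthrootP.
  have ex : exists N, `[< cube X (2 ^+ N * r) Y >] by exists N; apply/asboolP.
  (* The least dyadic cube that contains Y; index 0 is excluded since Y lies outside [cube X r]. *)
  have [[|j] /asboolP Yj jmin] := ex_minnP ex; first by move: Yj; rewrite mul1r.
  have Yj' : ~ cube X (2 ^+ j * r) Y.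
    by move/asboolP => /jmin; rewrite ltnn.
  rewrite (@nneseriesD1 _ _ j)//=; apply: (@le_trans _ _ (t j Y)); last first.
    by apply: leeDl; exact: nneseries_ge0.
  rewrite /t indicE mem_set// mulr1 lee_fin; apply: kernel_le => //.
  by rewrite leNgt; apply/negP => /norm_cube.
apply: (@le_trans _ _ (\int[lebesgue R d]_(Y in ~` cube X r) \sum_(j <oo) t j Y)%E).
  apply: (ge0_le_integral (lebesgue R d) mcube _ _ _ pointwise).
  - by move=> Y _; rewrite lee_fin kernel_ge0.
  - exact: ekernel_measurable.
  - by apply: measurable_funTS; exact: mts.
apply: (@le_trans _ _ (\int[lebesgue R d]_Y \sum_(j <oo) t j Y)%E).
  apply: (ge0_subset_integral (lebesgue R d) mcube (@measurableT _ space) mts).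
  - by move=> Y _; exact: nneseries_ge0.
  - exact: subsetT.
rewrite (integral_nneseries (lebesgue R d) (@measurableT _ space) mt); last first.
  by move=> j Y _; exact: t0.
have -> : far_const * r `^ (- s) = (4 ^+ d * r `^ (- s)) / (1 - z).
  by rewrite /far_const mulrAC.
apply: le_trans (nneseries_geometric_le _ z_gt0 z_lt1); last first.
  by rewrite mulr_ge0 ?powR_ge0// exprn_ge0.
rewrite le_eqVlt; apply/orP; left; apply/eqP; apply: eq_eseriesr => j _.
rewrite /t; under eq_integral do rewrite EFinM.
have mi : measurable_fun [set: space] 
    (fun Y : space => (\1_(cube X (2 ^+ j.+1 * r)) Y : R)%:E).
  by apply/measurable_EFinP; apply: measurable_indic; exact: cube_measurable.
rewrite (ge0_integralZl_EFin (lebesgue R d) (@measurableT _ space) _ mi); last 2 first.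
- by move=> Y _ /=; rewrite lee_fin indicE ler0n.
- by rewrite invr_ge0 powR_ge0.
rewrite (integral_indic (lebesgue R d) (@measurableT _ space)); last exact: cube_measurable.
rewrite setIT [X in (_ * X)%E](lebesgue_cube X (ltW (rj0 j.+1))).
rewrite -EFinM; congr EFin.
rewrite pow_split//.
have -> : 2 * (2 ^+ j.+1 * r) = 4 * (2 ^+ j * r) by rewrite exprS; ring.
rewrite [(4 * _) ^+ d]exprMn [(_ * r) `^ s]powRM ?ltW//.
have -> : (2 ^+ j) `^ s = (z ^+ j)^-1 :> R.
  by rewrite /z -!powR_mulrn ?powR_ge0// -!powRrM -powRN; congr (_ `^ _); ring.
rewrite powRN.
have u0 : (2 ^+ j * r) ^+ d != 0 by rewrite expf_neq0// gt_eqF.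
have v0 : z ^+ j != 0 by rewrite expf_neq0// gt_eqF.
have w0 : r `^ s != 0 by rewrite gt_eqF// powR_gt0.
move: u0 v0 w0; move: ((2 ^+ j * r) ^+ d) (z ^+ j) (r `^ s) (4 ^+ d) => u v w x.
by move=> u0 v0 w0; field; rewrite u0 v0 w0.
Qed.

(** Half the volume of a cube of radius 1 times the lower bound for the kernel at sup-distance at
    most 1. *)
Definition isop_const : R := 2 ^+ d / 2 * (Num.sqrt d%:R `^ (d%:R + s))^-1.

Lemma isop_const_gt0 : 0 < isop_const.
Proof.
rewrite /isop_const mulr_gt0 ?divr_gt0 ?exprn_gt0// invr_gt0 powR_gt0//.
by rewrite sqrtr_gt0 ltr0n.
Qed.

(** Around each X in A at least half of [cube X r] lies outside A, where the kernel is bounded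
    below; this bounds the potential of the complement at X. *)
Lemma interaction_setC_ge A r : 0 < r -> lebesgue_measurable A ->
  (forall X, A X -> (mu (A `&` cube X r) <= ((2 * r) ^+ d / 2)%:E)%E) ->
  ((isop_const * r `^ (- s))%:E * mu A <= interaction s A (~` A))%E.
Proof.
move=> r0 mA Ar.
have mA' : lebesgue_measurable (~` A) by exact: measurableC.
have sd0 : 0 < Num.sqrt d%:R :> R by rewrite sqrtr_gt0 ltr0n.
apply: interaction_ge => //.
  by rewrite lee_fin mulr_ge0 ?powR_ge0// ltW// isop_const_gt0.
move=> X AX.
have mQ : lebesgue_measurable (cube X r `\` A).
  by apply: measurableD => //; exact: cube_measurable.
pose K : R := ((Num.sqrt d%:R * r) `^ (d%:R + s))^-1.
have K0 : 0 <= K by rewrite invr_ge0 powR_ge0.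
apply: (@le_trans _ _ (K%:E * mu (cube X r `\` A))%E).
  have -> : isop_const * r `^ (- s) = K * ((2 * r) ^+ d / 2).
    rewrite /K powRM ?ltW// [r `^ (_ + _)]pow_split// powRN /isop_const exprMn.
    have u0 : r ^+ d != 0 by rewrite expf_neq0// gt_eqF.
    have v0 : r `^ s != 0 by rewrite gt_eqF// powR_gt0.
    have w0 : Num.sqrt d%:R `^ (d%:R + s) != 0 :> R by rewrite gt_eqF// powR_gt0.
    move: u0 v0 w0; move: (r ^+ d) (r `^ s) (Num.sqrt d%:R `^ _) (2 ^+ d) => u v w x.
    by move=> u0 v0 w0; field; rewrite u0 v0 w0.
  rewrite EFinM; apply: lee_pmul => //; rewrite ?lee_fin ?divr_ge0 ?exprn_ge0//.
    by rewrite mulr_ge0// ltW.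
  have cubeE := @lebesgue_cube R d X r (ltW r0).
  rewrite (measureD (cube_measurable X r) mA); last first.
    by change ((mu (cube X r) < +oo)%E); rewrite cubeE ltry.
  change (((2 * r) ^+ d / 2)%:E <= mu (cube X r) - mu (cube X r `&` A))%E.
  rewrite cubeE setIC.
  have := Ar _ AX; have := outer_measure_ge0 mu (A `&` cube X r).
  case: (mu _) => [m| |]//=.
  by rewrite !lee_fin => _; lra.
apply: (@le_trans _ _ (potential s (cube X r `\` A) X)).
  rewrite -(integral_cst (lebesgue R d) mQ).
  apply: (ge0_le_integral (lebesgue R d) mQ).
  - by move=> Y _; rewrite lee_fin.
  - exact: measurable_cst.
  - exact: ekernel_measurable.
  - move=> Y [/(cube_norm (ltW r0)) XYr AY]; rewrite lee_fin; apply: kernel_ge => //.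
    by apply/eqP => XY; apply: AY; rewrite -XY.
apply: (ge0_subset_integral (lebesgue R d) mQ mA').
- exact: ekernel_measurable.
- by move=> Y _; rewrite lee_fin kernel_ge0.
- by move=> Y [].
Qed.

End kernel_estimates.

(** * Averaging over the levels of a 1-Lipschitz function *)

Section averaging.
Variables (R : realType) (s : R).
Hypotheses (s_gt0 : 0 < s) (s_lt1 : s < 1).

(* The case distinction is needed since [u `^ x = 1] for [u < 0]. *)
Definition tail_pow (u : R) : R := if 0 < u then u `^ (- s) else 0.

Lemma tail_pow_ge0 u : 0 <= tail_pow u.
Proof. by rewrite /tail_pow; case: ifPn => // _; exact: powR_ge0. Qed.

Lemma tail_pow_measurable : measurable_fun [set: measurableTypeR R] tail_pow.
Proof.
have -> : tail_pow = fun u => \1_(`]0, +oo[%classic : set R) u * u `^ (- s).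
  apply/funext => u; rewrite /tail_pow indicE mem_setE in_itv/= andbT.
  by case: ifPn; rewrite ?mul1r ?mul0r.
apply: measurable_funM; last exact: measurable_powR.
by apply: measurable_indic; exact: measurable_itv.
Qed.

Let w : R := 2 `^ (- (1 - s)).

Let w_gt0 : 0 < w.
Proof. exact: powR_gt0. Qed.

Let w_lt1 : w < 1.
Proof.
rewrite /w powRN invf_lt1 ?powR_gt0//.
rewrite -[X in X < _](powRr0 (2 : R)).
by rewrite /powR pnatr_eq0/= mul0r ltr_expR mulr_gt0 ?subr_gt0// ln_gt0// ltr1n.
Qed.

Definition avg_const : R := 2 `^ s / (1 - w).

Lemma avg_const_gt0 : 0 < avg_const.
Proof. by rewrite /avg_const divr_gt0 ?powR_gt0// subr_gt0. Qed.

(** Dyadic decomposition towards the singularity: with h_j = (K2 - K1) / 2^j, the weight is at most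
    h_(j+1)^(-s) on a piece of length at most h_j. The series is geometric of ratio 2^(s-1), below 1
    because s < 1, and the bound is uniform in u. *)
Lemma integral_tail_pow (K1 K2 u : R) : K1 < K2 ->
  (\int[@lebesgue_measure R]_(K in `]K1, K2]) (tail_pow (K - u))%:E <=
   (avg_const * (K2 - K1) `^ (1 - s))%:E)%E.
Proof.
move=> K12; set h := K2 - K1; have h0 : 0 < h by rewrite subr_gt0.
have a1 (K v : R) : K2 - K1 < K - v -> K <= K2 -> K1 <= v -> False by lra.
have a2 (K v k : R) : v < K -> K - v <= k -> v < K <= v + k by lra.
have a3 (K v v' k : R) : k < K - v -> v' <= v -> k <= K - v' by lra.
(* For u < K1 the singularity lies outside the interval; moving it to K1 only increases the
   weight. *)
pose v := Num.max u K1.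
pose h_ j := h / 2 ^+ j.
have h_0 j : 0 < h_ j by rewrite divr_gt0// exprn_gt0.
pose t j (K : measurableTypeR R) : \bar R :=
  (h_ j.+1 `^ (- s) * \1_(`]v, v + h_ j]%classic : set R) K)%:E.
have t0 j K : (0 <= t j K)%E.
  by rewrite lee_fin mulr_ge0 ?powR_ge0// indicE ler0n.
have mi j : measurable (`]v, v + h_ j]%classic : set (measurableTypeR R)).
  exact: measurable_itv.
have mt j : measurable_fun [set: measurableTypeR R] (t j).
  apply/measurable_EFinP; apply: measurable_funM; first exact: measurable_cst.
  exact: measurable_indic.
have mts : measurable_fun [set: measurableTypeR R] (fun K => \sum_(j <oo) t j K)%E.
  by apply: ge0_emeasurable_sum => [j Y _ _|j _]; [exact: t0|exact: mt].
have mK : measurable (`]K1, K2]%classic : set (measurableTypeR R)).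
  exact: measurable_itv.
have pointwise K : `]K1, K2]%classic K ->
    ((tail_pow (K - u))%:E <= \sum_(j <oo) t j K)%E.
  rewrite /= in_itv/= => /andP[K1K KK2].
  rewrite /tail_pow; case: ifPn => [Ku|_]; last by apply: nneseries_ge0.
  have vK : v < K by rewrite /v gt_max K1K -subr_gt0 Ku.
  have K1v : K1 <= v by rewrite /v le_max lexx orbT.
  have uv : u <= v by rewrite /v le_max lexx.
  have [N hN] : exists N, h_ N < K - v.
    exists (Num.bound (h / (K - v))); rewrite /h_ ltr_pdivrMr ?exprn_gt0//.
    by rewrite mulrC -ltr_pdivrMr ?subr_gt0// upper_nthrootP.
  have ex : exists N, h_ N < K - v by exists N.
  have [[|j] Yj jmin] := ex_minnP ex.
    by move: Yj; rewrite /h_ expr0 divr1 => /a1 /(_ KK2 K1v).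
  have Yj' : K - v <= h_ j.
    by rewrite leNgt; apply/negP => /jmin; rewrite ltnn.
  rewrite (@nneseriesD1 _ _ j)//=; apply: (@le_trans _ _ (t j K)); last first.
    by apply: leeDl; apply: nneseries_ge0 => ? _ _; exact: t0.
  rewrite /t indicE mem_set; last first.
    by rewrite /= in_itv/= a2.
  rewrite mulr1 lee_fin !powRN lef_pV2 ?posrE ?powR_gt0//.
  have Ku' : h_ j.+1 <= K - u by exact: (a3 _ _ _ _ Yj uv).
  by apply: ge0_ler_powR; rewrite ?nnegrE ?(ltW s_gt0) ?(ltW Ku) ?(ltW (h_0 _)).
apply: (@le_trans _ _ (\int[@lebesgue_measure R]_(K in `]K1, K2]) \sum_(j <oo) t j K)%E).
  apply: (ge0_le_integral (@lebesgue_measure R) mK _ _ _ pointwise).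
  - by move=> K _; rewrite lee_fin tail_pow_ge0.
  - apply/measurable_funTS/measurable_EFinP.
    apply: (measurableT_comp tail_pow_measurable).
    exact: measurable_funB.
  - by apply: measurable_funTS; exact: mts.
apply: (@le_trans _ _ (\int[@lebesgue_measure R]_K \sum_(j <oo) t j K)%E).
  apply: (ge0_subset_integral (@lebesgue_measure R) mK (@measurableT _ (measurableTypeR R)) mts).
  - by move=> Y _; apply: nneseries_ge0 => ? _ _; exact: t0.
  - exact: subsetT.
rewrite (integral_nneseries (@lebesgue_measure R)
  (@measurableT _ (measurableTypeR R)) mt); last first.
  by move=> j Y _; exact: t0.
have -> : avg_const * h `^ (1 - s) = (2 `^ s * h `^ (1 - s)) / (1 - w).
  by rewrite /avg_const mulrAC.
apply: le_trans (nneseries_geometric_le _ w_gt0 w_lt1); last first.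
  by rewrite mulr_ge0 ?powR_ge0.
rewrite le_eqVlt; apply/orP; left; apply/eqP; apply: eq_eseriesr => j _.
rewrite /t; under eq_integral do rewrite EFinM.
have mj : measurable_fun [set: measurableTypeR R]
    (fun K : measurableTypeR R => (\1_(`]v, v + h_ j]%classic : set R) K : R)%:E).
  by apply/measurable_EFinP; apply: measurable_indic; exact: mi.
rewrite (ge0_integralZl_EFin (@lebesgue_measure R)
  (@measurableT _ (measurableTypeR R)) _ mj); last 2 first.
- by move=> Y _ /=; rewrite lee_fin indicE ler0n.
- exact: powR_ge0.
rewrite (integral_indic (@lebesgue_measure R) (@measurableT _ (measurableTypeR R)))//.
rewrite setIT [X in (_ * X)%E](lebesgue_measure_itv `]v, v + h_ j]) /= lte_fin ltrDl h_0.
rewrite -EFinB -EFinM; congr EFin.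
have -> : v + h_ j - v = h_ j by ring.
have -> : h_ j.+1 = h_ j / 2 by rewrite /h_ exprS; field; rewrite gt_eqF// exprn_gt0.
have hj : h_ j `^ (- s) * h_ j = h_ j `^ (1 - s).
  rewrite -{2}(powRr1 (ltW (h_0 j))) -powRD; last by apply/implyP => _; rewrite gt_eqF.
  by rewrite addrC.
have i2 : 0 <= 2^-1 :> R by rewrite invr_ge0.
rewrite powRM ?(ltW (h_0 j))// mulrAC hj.
have -> : 2^-1 `^ (- s) = 2 `^ s :> R.
  by rewrite -powR_inv1// -powRrM; congr (_ `^ _); ring.
have -> : h_ j `^ (1 - s) = h `^ (1 - s) * w ^+ j.
  rewrite /h_ -(@powR_mulrn _ 2)// -powRN powRM ?powR_ge0 ?(ltW h0)//; congr (_ * _).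
  have -> : w ^+ j = 2 `^ (- (1 - s) * j%:R) by rewrite powRrM powR_mulrn ?powR_ge0.
  by rewrite -powRrM; congr (_ `^ _); ring.
ring.
Qed.

End averaging.

Section averaged_interaction.
Variables (R : realType) (d : nat) (s : R).
Hypotheses (s_gt0 : 0 < s) (s_lt1 : s < 1).
Local Notation mu := (@lebesgue_outer R d).
Local Notation space := (lebesgue_space R d).
Implicit Types (A B E U : set 'rV[R]_d) (X Y : 'rV[R]_d).

Variable phi : 'rV[R]_d -> R.
Hypothesis phi_lip : forall X Y, `|phi X - phi Y| <= `|X - Y|.

Lemma lip1_continuous : continuous phi.
Proof.
by apply: (@lipschitz_continuous _ _ _ _ 1) => X Y; rewrite mul1r.
Qed.

Lemma lip1_measurable : measurable_fun [set: space] (phi : space -> R).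
Proof. by apply: continuous_lebesgue_measurable; exact: lip1_continuous. Qed.

Lemma sublevel_measurable K : lebesgue_measurable [set X | phi X < K].
Proof.
have := @lip1_measurable (@measurableT _ space) `]-oo, K[%classic (measurable_itv _).
by rewrite setTI.
Qed.

Lemma superlevel_measurable K : lebesgue_measurable [set X | K <= phi X].
Proof.
have -> : [set X | K <= phi X] = ~` [set X | phi X < K].
  by apply/seteqP; split=> X /=; rewrite leNgt => /negP.
by apply: measurableC; exact: sublevel_measurable.
Qed.

(** By the Lipschitz bound the superlevel set avoids the cube of radius (K - phi X) / 2 about X. The
    halved radius provides a strict inequality, as the cube contains part of its boundary, and costs
    the factor 2^s. *)
Lemma potential_superlevel X K : phi X < K ->
  (potential s [set Y | (K <= phi Y)%R] X <=
   (far_const d s * 2 `^ s * tail_pow s (K - phi X))%:E)%E.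
Proof.
move=> XK; have K0 : 0 < K - phi X by rewrite subr_gt0.
have -> : far_const d s * 2 `^ s * tail_pow s (K - phi X) =
    far_const d s * ((K - phi X) / 2) `^ (- s).
  rewrite /tail_pow K0 powRM ?(ltW K0) ?invr_ge0// -powR_inv1// -powRrM.
  by rewrite mulrN mulN1r opprK; ring.
have r0 : 0 < (K - phi X) / 2 by rewrite divr_gt0.
apply: le_trans (potential_far s_gt0 X r0).
apply: (ge0_subset_integral (lebesgue R d)) => /=.
- exact: superlevel_measurable.
- by apply: measurableC; exact: cube_measurable.
- by apply: ekernel_measurable => //; apply: measurableC; exact: cube_measurable.
- by move=> Y _; rewrite lee_fin kernel_ge0.
- move=> Y /= KY /(cube_norm (ltW r0)) XY.
  by have := phi_lip X Y; rewrite ler_norml; lra.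
Qed.

Definition shell_const : R := far_const d s * 2 `^ s * avg_const s.

Lemma shell_const_gt0 : 0 < shell_const.
Proof.
apply: mulr_gt0; last exact: avg_const_gt0.
by apply: mulr_gt0; [exact: far_const_gt0|exact: powR_gt0].
Qed.

(* Integrating the hypothesis over the level turns the potential of the
   superlevel set, which is of order (K - phi X)^-s, into an integrable
   weight: here s < 1 is used. *)
Lemma interaction_sublevel_average (E : set 'rV[R]_d) (c K1 K2 : R) :
  lebesgue_measurable E -> 0 <= c -> K1 < K2 ->
  (forall K, K1 < K <= K2 ->
    (c%:E <= interaction s (E `&` [set X | (phi X < K)%R]) [set Y | (K <= phi Y)%R])%E) ->
  (c%:E <= (shell_const * (K2 - K1) `^ (- s))%:E *
    mu (E `&` [set X | (phi X < K2)%R]))%E.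
Proof.
move=> mE c0 K12 H; set h := K2 - K1; have h0 : 0 < h by rewrite subr_gt0.
pose C1 := far_const d s * 2 `^ s.
have C10 : 0 <= C1 by rewrite mulr_ge0 ?powR_ge0// ltW// far_const_gt0.
pose G := E `&` [set X | phi X < K2].
have mI B C : lebesgue_measurable B -> lebesgue_measurable C ->
    lebesgue_measurable (B `&` C) by move=> ? ?; exact: measurableI.
have mG : lebesgue_measurable G by apply: mI => //; exact: sublevel_measurable.
have mK : measurable (`]K1, K2]%classic : set (measurableTypeR R)).
  exact: measurable_itv.
pose F (p : measurableTypeR R * space) : \bar R :=
  (C1 * tail_pow s (p.1 - phi p.2) * \1_G p.2 * \1_(`]K1, K2]%classic : set R) p.1)%:E.
have F0 p : (0 <= F p)%E.
  rewrite lee_fin !indicE; apply: mulr_ge0 => //; apply: mulr_ge0 => //.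
  by apply: mulr_ge0 => //; exact: tail_pow_ge0.
have mphi2 : measurable_fun [set: measurableTypeR R * space] (fun p => phi p.2).
  exact: (measurableT_comp lip1_measurable measurable_snd).
have mF : measurable_fun [set: measurableTypeR R * space] F.
  apply/measurable_EFinP; apply: measurable_funM; [apply: measurable_funM|].
  - apply: measurable_funM; first exact: measurable_cst.
    apply: (measurableT_comp (@tail_pow_measurable R s)).
    by apply: measurable_funB; [exact: measurable_fst|exact: mphi2].
  - by apply: (measurableT_comp _ measurable_snd); exact: measurable_indic.
  - by apply: (measurableT_comp _ measurable_fst); exact: measurable_indic.
have lower : ((c * h)%:E <= \int[@lebesgue_measure R]_K \int[lebesgue R d]_X F (K, X))%E.
  have -> : ((c * h)%:E = \int[@lebesgue_measure R]_(K in `]K1, K2]) (cst c%:E) K)%E.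
    rewrite (integral_cst (@lebesgue_measure R) mK).
    rewrite [X in (_ * X)%E](lebesgue_measure_itv `]K1, K2]) /= lte_fin K12.
    by rewrite -EFinB -EFinM.
  rewrite [leLHS]integral_mkcond.
  apply: (ge0_le_integral (@lebesgue_measure R) (@measurableT _ (measurableTypeR R))).
  - by move=> K _; rewrite patchE; case: ifP => // _; rewrite lee_fin.
  - apply/(measurable_restrictT _ mK).
    exact: measurable_cst.
  - by apply: (measurable_fun_fubini_tonelli_F F mF F0).
  move=> K _; rewrite patchE; case: ifPn => [|_]; last first.
    by apply: integral_ge0 => X _; exact: F0.
  move=> /set_mem KI; have := KI; rewrite /= in_itv/= => KK.
  have mA : lebesgue_measurable (E `&` [set X | phi X < K]).
    by apply: mI => //; exact: sublevel_measurable.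
  apply: (le_trans (H K KK)).
  rewrite interactionE [leLHS]integral_mkcond.
  apply: (ge0_le_integral (lebesgue R d) (@measurableT _ space)).
  - by move=> X _; rewrite patchE; case: ifP => // _; exact: potential_ge0.
  - apply/(measurable_restrictT _ mA).
    by apply: potential_measurable => //; exact: superlevel_measurable.
  - exact: (measurable_fun_pair2 (K : measurableTypeR R) mF).
  move=> X _; rewrite patchE; case: ifPn => [/set_mem [EX XK]|_]; last exact: F0.
  apply: (le_trans (potential_superlevel XK)).
  rewrite /F/= !indicE !mem_set ?mulr1//.
  by split=> //=; case/andP: KK => _; exact: lt_le_trans.
(* After the exchange X is fixed and the level varies, so [integral_tail_pow] applies with u = phi
   X. *)
rewrite (fubini_tonelli F mF F0) in lower.
have upper : (\int[lebesgue R d]_X \int[@lebesgue_measure R]_K F (K, X) <=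
    (shell_const * h `^ (1 - s))%:E * mu G)%E.
  rewrite -(integral_cst (lebesgue R d) mG) [leRHS]integral_mkcond.
  have S0 : 0 <= shell_const * h `^ (1 - s).
    by rewrite mulr_ge0 ?powR_ge0// ltW// shell_const_gt0.
  apply: (ge0_le_integral (lebesgue R d) (@measurableT _ space)).
  - by move=> X _; apply: integral_ge0 => K _; exact: F0.
  - exact: (measurable_fun_fubini_tonelli_G F mF F0).
  - apply/(measurable_restrictT _ mG).
    exact: measurable_cst.
  move=> X _; rewrite patchE; case: ifPn => [XG|XG]; last first.
    rewrite integral0_eq// => K _; rewrite /F/= indicE (negPf XG).
    by rewrite mulr0 mul0r.
  have mt : measurable_fun `]K1, K2] (fun K : measurableTypeR R =>
      (tail_pow s (K - phi X))%:E).
    apply/measurable_funTS/measurable_EFinP.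
    apply: (measurableT_comp (@tail_pow_measurable R s)).
    exact: measurable_funB.
  have -> : (\int[@lebesgue_measure R]_K F (K, X) =
      \int[@lebesgue_measure R]_(K in `]K1, K2]) (C1%:E * (tail_pow s (K - phi X))%:E))%E.
    rewrite [RHS]integral_mkcond; apply: eq_integral => K _.
    rewrite patchE /F/= !indicE XG mulr1 -EFinM.
    by case: (K \in _); rewrite ?mulr1 ?mulr0.
  rewrite (ge0_integralZl_EFin (@lebesgue_measure R) mK _ mt)//; last first.
    by move=> K _; rewrite lee_fin tail_pow_ge0.
  rewrite /cst /shell_const -/C1 -[leRHS]/((C1 * _ * _)%:E) -mulrA [leRHS]EFinM.
  apply: lee_wpmul2l; first by rewrite lee_fin.
  exact: integral_tail_pow.
have := le_trans lower upper.
have -> : shell_const * h `^ (1 - s) = shell_const * h `^ (- s) * h.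
  rewrite -mulrA; congr (_ * _).
  rewrite -{3}(powRr1 (ltW h0)) -powRD; last by apply/implyP => _; rewrite gt_eqF.
  by rewrite addrC.
by rewrite EFinM [(shell_const * _ * _)%:E]EFinM -muleA [(h%:E * _)%E]muleC muleA lee_pmul2r//.
Qed.

End averaged_interaction.

(** * The boundary layer of the cylinder *)

Section base_height.
Variables (R : realType) (n : nat).
Implicit Types (X Y : 'rV[R]_(n + 1)).

Lemma baseE X i : base X 0 i = X 0 (lshift 1 i).
Proof. by rewrite mxE. Qed.

Lemma heightE X : height X = X 0 (rshift n 0).
Proof. by rewrite /height mxE. Qed.

Lemma baseB X Y : base (X - Y) = base X - base Y.
Proof. exact: raddfB. Qed.

Lemma heightB X Y : height (X - Y) = height X - height Y.
Proof. by rewrite !heightE !mxE. Qed.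

Lemma norm_base_le X : `|base X| <= `|X|.
Proof.
apply/rV_norm_le => // i; rewrite baseE; exact: rV_coord_le.
Qed.

Lemma norm_height_le X : `|height X| <= `|X|.
Proof. by rewrite heightE; exact: rV_coord_le. Qed.

Lemma rV_norm_base_height X (r : R) : `|base X| <= r -> `|height X| <= r -> `|X| <= r.
Proof.
move=> bX hX; have r0 := le_trans (normr_ge0 _) bX.
apply/rV_norm_le => // i; rewrite -[X]hsubmxK mxE.
case: splitP => j _.
  exact: ((rV_norm_le _ r0).1 bX).
by rewrite (ord1 j).
Qed.

End base_height.

Section distance.
Variables (R : realType) (n : nat) (Omega : set 'rV[R]_n).
Hypothesis Omega_neqT : exists y, ~ Omega y.
Implicit Types x y : 'rV[R]_n.

Definition dist x : R := inf [set `|x - y| | y in ~` Omega].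

Let set_neq0 x : [set `|x - y| | y in ~` Omega] !=set0.
Proof. by have [y Oy] := Omega_neqT; exists `|x - y|, y. Qed.

Let set_lb x : has_lbound [set `|x - y| | y in ~` Omega].
Proof. by exists 0 => _ [y _ <-]. Qed.

Lemma dist_ge0 x : 0 <= dist x.
Proof. by apply: lb_le_inf => // _ [y _ <-]. Qed.

Lemma dist_le x y : ~ Omega y -> dist x <= `|x - y|.
Proof. by move=> Oy; apply: ge_inf => //; exists y. Qed.

Lemma dist_lt x (r : R) : dist x < r -> exists2 y, ~ Omega y & `|x - y| < r.
Proof. by move=> /(inf_lt (set_neq0 x)) [_ [y Oy <-] ?]; exists y. Qed.

Lemma dist_lip x y : `|dist x - dist y| <= `|x - y|.
Proof.
have H u v : dist u - dist v <= `|u - v|.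
  rewrite lerBlDr -lerBlDl; apply: lb_le_inf => // _ [w Ow <-].
  rewrite lerBlDl; apply: le_trans (dist_le u Ow) _.
  by rewrite (_ : u - w = (u - v) + (v - w)) ?ler_normD// addrA subrK.
rewrite ler_norml H andbT lerNl opprB (distrC x y); exact: H.
Qed.

Lemma dist_gt0_in x : 0 < dist x -> Omega x.
Proof.
move=> d0; apply: contrapT => /(dist_le x); rewrite subrr normr0.
by rewrite leNgt d0.
Qed.

Lemma dist_open x : open Omega -> Omega x -> 0 < dist x.
Proof.
move=> oO Ox; have /nbhs_ballP [e /= e0 xeO] : nbhs x Omega by exact: open_nbhs_nbhs.
rewrite lt_neqAle dist_ge0 andbT; apply/negP => /eqP d0.
have /dist_lt [y Oy xy] : dist x < e by rewrite -d0.
by apply: Oy; apply: xeO; rewrite mx_norm_ball.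
Qed.

End distance.

(** * Mean value inequality and packing by translates *)

(** The one-dimensional theorem along the segment. The bound is asked on the segment only, since a
    Lipschitz gradient is bounded just locally; the factor m comes from summing the partial
    derivatives. *)
Lemma MVT_rV_le (R : realType) (m : nat) (g : 'rV[R]_m -> R) (C : R)
    (z z' : 'rV[R]_m) :
  (forall x, differentiable g x) ->
  (forall t, 0 <= t <= 1 -> `|gradient g (z' + t *: (z - z'))| <= C) ->
  `|g z - g z'| <= m%:R * C * `|z - z'|.
Proof.
move=> dg gC; set w := z - z'.
pose h (t : R) := g (z' + t *: w).
have hd (t : R) : is_derive t (1 : R) h ('D_w g (z' + t *: w)).
  have e : (fun k : R => k^-1 *: ((h \o shift t) (k *: (1 : R)) - h t)) =
           (fun k : R => k^-1 *: ((g \o shift (z' + t *: w)) (k *: w) - g (z' + t *: w))).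
    apply/funext => k; congr (_ *: (_ - _)); rewrite /h /=; congr g.
    by rewrite /shift/= [k *: (1 : R)]mulr1 scalerDl addrCA.
  have dw : derivable g (z' + t *: w) w by exact: diff_derivable.
  split; first by rewrite /derivable e.
  by rewrite /derive e.
have [|c c01] := @MVT R h (fun t => 'D_w g (z' + t *: w)) 0 1 ltr01 (fun t _ => hd t).
  apply: derivable_within_continuous => t _; exact: (@ex_derive _ _ _ _ _ _ _ (hd t)).
rewrite /h scale1r scale0r addr0 subr0 mulr1 /w subrKC => ->.
rewrite deriveE// -/w; set D := 'd g _.
have -> : D w = \sum_(i < m) w 0 i * D (delta_mx 0 i).
  rewrite {1}[w]row_sum_delta linear_sum; apply: eq_bigr => i _; exact: linearZ.
apply: le_trans (ler_norm_sum _ _ _) _.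
rewrite -mulrA -[m in m%:R]card_ord -sum1_card natr_sum mulr_suml.
apply: ler_sum => i _; rewrite mul1r normrM mulrC.
apply: ler_pM => //; last exact: rV_coord_le.
have : `|gradient g (z' + c *: w) 0 i| <= C.
  apply: le_trans (rV_coord_le _ _) _; apply: gC.
  by move: c01; rewrite in_itv/= => /andP[? ?]; rewrite !ltW.
by rewrite mxE deriveE.
Qed.

Section packing.
Variables (R : realType) (d : nat).
Local Notation mu := (@lebesgue_outer R d).
Local Notation space := (lebesgue_space R d).
Implicit Types (A S D : set 'rV[R]_d).

Lemma shift_lebesgue_measurable A (c : 'rV[R]_d) : lebesgue_measurable A ->
  lebesgue_measurable [set x + c | x in A].
Proof.
move=> mA; apply: le_caratheodory_measurable => B.
have sh (C : set 'rV[R]_d) : B `&` [set x | C (x - c)] =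
    [set x + c | x in [set x + - c | x in B] `&` C].
  apply/seteqP; split=> [x [Bx Cx]|_ [_ [[x Bx <-] Cx] <-]].
    by exists (x - c); [split=> //; exists x|rewrite subrK].
  by rewrite subrK.
have -> : [set x + c | x in A] = [set x | A (x - c)].
  apply/seteqP; split=> [_ [x Ax <-]|x Ax]; first by rewrite /= addrK.
  by exists (x - c) => //; rewrite subrK.
change (mu (B `&` [set x | A (x - c)%R]) +
  mu (B `&` [set x | (~` A) (x - c)%R]) <= mu B)%E.
rewrite !sh !outer_shift -[leRHS](outer_shift B (- c)).
by rewrite le_eqVlt -(mA [set x + - c | x in B]) eqxx.
Qed.

(* The translates of S by multiples of t e lie in disjoint level strips of f. *)
Lemma packing S D (f : 'rV[R]_d -> R) (e : 'rV[R]_d) (t : R) (N : nat) :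
  lebesgue_measurable S -> 0 < t ->
  (forall X u, f (X + u *: e) = f X + u) ->
  (forall X, S X -> 0 < f X <= t) ->
  (forall j X, (j < N)%N -> S X -> D (X + (j%:R * t) *: e)) ->
  (N%:R%:E * mu S <= mu D)%E.
Proof.
move=> mS t0 fe Sf SD.
pose T (j : 'I_N) : set space := [set X + (j%:R * t) *: e | X in S].
have mT j : measurable (T j) by exact: shift_lebesgue_measurable.
have tT : trivIset [set: 'I_N] T.
  apply/trivIsetP => i j _ _ ij; apply/seteqP; split=> // _ [[X SX <-] [Y SY]].
  move=> /(congr1 f); rewrite !fe => fXY; apply/negP: ij; rewrite negbK.
  have := Sf _ SX; have := Sf _ SY => /andP[Y0 Yt] /andP[X0 Xt].
  apply/eqP/val_inj/eqP; rewrite /= eqn_leq.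
  by apply/andP; split; rewrite -ltnS -(ltr_nat R) -(ltr_pM2r t0) -natr1 mulrDl
    mul1r; lra.
have -> : (N%:R%:E * mu S = \sum_(j < N) mu (T j))%E.
  under eq_bigr do rewrite outer_shift.
  by rewrite sumr_const card_ord mule_natl.
rewrite -[X in (X <= _)%E](measure_bigsetU_ord (lebesgue R d) xpredT mT tT).
apply: le_outer_measure.
elim/big_ind: _ => [//|A B AD BD X [/AD|/BD]//|j _ _ [X SX <-]]; exact: SD.
Qed.

End packing.

Section row_maps.
Variables (R : realType).

Lemma norm_mulmx_le (m k : nat) (B : 'M[R]_(m, k)) :
  exists2 C : R, 0 <= C & forall x : 'rV[R]_m, `|x *m B| <= C * `|x|.
Proof.
exists (\sum_(i < m) \sum_(j < k) `|B i j|).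
  by apply: sumr_ge0 => i _; apply: sumr_ge0.
move=> x; apply/rV_norm_le.
  by rewrite mulr_ge0//; apply: sumr_ge0 => i _; apply: sumr_ge0.
move=> j; rewrite mxE mulr_suml; apply: le_trans (ler_norm_sum _ _ _) _.
apply: ler_sum => i _; rewrite normrM mulrC ler_pM//; last exact: rV_coord_le.
by rewrite (bigD1 j)//= lerDl sumr_ge0.
Qed.

End row_maps.

Lemma closure_le (R : realType) (T : topologicalType) (A : set T) (f : T -> R) (a : R) x :
  continuous f -> (forall y, A y -> f y <= a) -> closure A x -> f x <= a.
Proof.
move=> cf Aa; have cl : closed (f @^-1` `]-oo, a]%classic).
  by apply: closed_comp => [y _|]; [exact: cf|exact: interval_closed].
have AB : A `<=` f @^-1` `]-oo, a]%classic by move=> y /Aa; rewrite /= in_itv.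
by move=> /(closureS AB); rewrite -((closure_id _).1 cl) /= in_itv.
Qed.

(** * Linear bound for the measure of the lateral layer *)

Section boundary_layer.
Variables (R : realType) (n : nat) (Omega : set 'rV[R]_n).
Hypotheses (n_gt0 : (0 < n)%N) (Omega_open : open Omega)
  (Omega_bounded : bounded_set Omega) (Omega_C11 : C11_boundary Omega).
Local Notation mu := (@lebesgue_outer R (n + 1)).
Local Notation dist := (dist Omega).

Lemma bounded_set_le : exists2 rho : R, 0 < rho & forall x, Omega x -> `|x| <= rho.
Proof.
have [M [_ HM]] := Omega_bounded.
exists (Num.max 1 (M + 1)); first by rewrite lt_max ltr01.
by move=> x Ox; apply: HM => //; rewrite lt_max ltrDl ltr01 orbT.
Qed.

(** Here n > 0 enters: R^0 itself is bounded. *)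
Lemma bounded_neqT : exists y, ~ Omega y.
Proof.
have [rho rho0 H] := bounded_set_le; exists (const_mx (rho + 1)) => /H.
move=> /(le_trans (rV_coord_le _ (Ordinal n_gt0))); rewrite mxE ger0_norm; lra.
Qed.

Variables (p K : R).

Definition layer (V : set 'rV[R]_n) (eta : R) : set 'rV[R]_(n + 1) :=
  [set X | [/\ V (base X), Omega (base X), dist (base X) < eta &
    `|height X - p| < K]].

Let row_e (e : 'rV[R]_n) : 'rV[R]_(n + 1) := row_mx e 0.

Let base_row_e e (X : 'rV[R]_(n + 1)) (u : R) :
  base (X + u *: row_e e) = base X + u *: e.
Proof. by rewrite /base linearD linearZ/= /row_e row_mxKl. Qed.

Let height_row_e e (X : 'rV[R]_(n + 1)) (u : R) :
  height (X + u *: row_e e) = height X.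
Proof. by rewrite /height linearD linearZ/= /row_e row_mxKr scaler0 addr0. Qed.

(* Near a boundary point of a Lipschitz graph, the layer lies in the set
   {0 < H - g o T <= c eta}, about 1 / (c eta) disjoint translates of which fit
   into a fixed cube. *)
Lemma layer_near_boundary q : (closure Omega `\` interior Omega) q ->
  exists (V : set 'rV[R]_n) (C eta0 : R), [/\ open V, V q, 0 <= C, 0 < eta0 &
    forall eta, 0 < eta < eta0 -> (mu (layer V eta) <= (C * eta)%:E)%E].
Proof.
move=> /Omega_C11 [r [Q [g [r0 QQ [dg [L gL]] chart]]]].
have sn0 : 0 < Num.sqrt n%:R :> R by rewrite sqrtr_gt0 ltr0n.
pose rho := r / Num.sqrt n%:R.
have rho0 : 0 < rho by exact: divr_gt0.
have {}chart x : `|x - q| < rho ->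
    (Omega x <-> g (base (x *m Q^T)) < height (x *m Q^T)).
  move=> xq; apply: chart; apply: le_lt_trans (enorm_le_norm _) _.
  by rewrite mulrC -ltr_pdivlMr.
have [CQ CQ0 QC] := norm_mulmx_le (Q^T).
pose T (x : 'rV[R]_n) := base (x *m Q^T).
pose H (x : 'rV[R]_n) := height (x *m Q^T).
have TC x y : `|T x - T y| <= CQ * `|x - y|.
  by rewrite /T -baseB -mulmxBl; apply: le_trans (norm_base_le _) _.
have HC x y : `|H x - H y| <= CQ * `|x - y|.
  by rewrite /H -heightB -mulmxBl; apply: le_trans (norm_height_le _) _.
(* A bound for the gradient on the ball of radius [CQ * rho] about [T q], which contains the image
   of the chart under [T]. *)
pose G := `|gradient g (T q)| + `|L| * (CQ * rho).
have gG z : `|z - T q| <= CQ * rho -> `|gradient g z| <= G.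
  move=> zq; rewrite -[gradient g z](subrK (gradient g (T q))) addrC.
  apply: le_trans (ler_normD _ _) _; rewrite /G lerD2l.
  have := gL (z, T q) (conj I I); rewrite /self_sub /= => h.
  apply: (le_trans h); apply: (@le_trans _ _ (`|L| * `|z - T q|)).
    by rewrite ler_wpM2r// ler_norm.
  by rewrite ler_wpM2l.
have G0 : 0 <= G by rewrite addr_ge0// mulr_ge0// mulr_ge0// ltW.
pose Lg := n.-1%:R * G.
have Lg0 : 0 <= Lg by rewrite mulr_ge0.
have gLip x y : `|x - q| <= rho -> `|y - q| <= rho ->
    `|g (T x) - g (T y)| <= Lg * `|T x - T y|.
  move=> xq yq; apply: MVT_rV_le => // t /andP[t0 t1]; apply: gG.
  have -> : T y + t *: (T x - T y) - T q = t *: (T x - T q) + (1 - t) *: (T y - T q).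
    by rewrite !scalerBr !scalerBl !scale1r; apply/rowP => i; rewrite !mxE; ring.
  have t1' : 0 <= 1 - t by rewrite subr_ge0.
  apply: le_trans (ler_normD _ _) _; rewrite !normrZ !ger0_norm//.
  have hx := le_trans (TC x q) (ler_wpM2l CQ0 xq).
  have hy := le_trans (TC y q) (ler_wpM2l CQ0 yq).
  have := ler_wpM2l t0 hx; have := ler_wpM2l t1' hy; lra.
pose c0 := (Lg + 1) * CQ + 1.
have c00 : 0 < c0 by rewrite ltr_wpDl// mulr_ge0// addr_ge0.
pose V := [set x : 'rV[R]_n | `|q - x| < rho / 2].
pose f (X : 'rV[R]_(n + 1)) := H (base X) - g (T (base X)).
pose S eta : set 'rV[R]_(n + 1) :=
  [set X | [/\ `|q - base X| < rho / 2, `|height X - p| < K & 0 < f X <= c0 * eta]].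
(* Within eta of a layer point there is a y outside Omega. It lies on or below the graph and the
   layer point above it, so the Lipschitz bounds for [H] and g o T give f <= c0 * eta; the summand 1
   in [c0] keeps it positive. *)
have layerS eta : 0 < eta < rho / 2 -> layer V eta `<=` S eta.
  move=> /andP[e0 er] X [VX OX dX hX]; split=> //.
  have [y Oy Xy] := dist_lt bounded_neqT dX.
  have Xq : `|base X - q| < rho by move: VX; rewrite /V/= distrC; lra.
  have yq : `|y - q| < rho.
    rewrite -[y - q](subrKA (base X)); apply: le_lt_trans (ler_normD _ _) _.
    by move: VX; rewrite /V/= distrC (distrC y); lra.
  have fX : 0 < f X by rewrite subr_gt0; apply/chart.
  rewrite fX /=.
  have fy : H y <= g (T y) by rewrite leNgt; apply/negP => ?; apply: Oy; apply/chart.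
  have h1 : H (base X) - H y <= CQ * eta.
    apply: le_trans (ler_norm _) _; apply: le_trans (HC _ _) _.
    by rewrite ler_wpM2l// ltW.
  have h2 : g (T y) - g (T (base X)) <= Lg * (CQ * eta).
    apply: le_trans (ler_norm _) _; apply: le_trans (gLip _ _ (ltW yq) (ltW Xq)) _.
    rewrite ler_wpM2l//; apply: le_trans (TC _ _) _.
    by rewrite ler_wpM2l// distrC ltW.
  by rewrite /f /c0; nra.
(* The vertical unit vector of the chart: translation by u e fixes [T] and raises [H] by u. *)
pose e : 'rV[R]_n := row_mx (0 : 'rV[R]_(n.-1)) (1%:M : 'M[R]_1) *m Q.
have eQ : e *m Q^T = row_mx 0 1%:M by rewrite /e -mulmxA QQ mulmx1.
have Te x u : T (x + u *: e) = T x.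
  by rewrite /T mulmxDl -scalemxAl eQ /base linearD linearZ/= row_mxKl scaler0 addr0.
have He x u : H (x + u *: e) = H x + u.
  rewrite /H mulmxDl -scalemxAl eQ /height linearD linearZ/= row_mxKr.
  by rewrite !mxE eqxx mulr1.
have fe X u : f (X + u *: row_e e) = f X + u.
  by rewrite /f base_row_e Te He addrAC.
have cbase : continuous (@base R n).
  apply: (@lipschitz_continuous _ _ _ _ 1) => x y.
  by rewrite mul1r -baseB; exact: norm_base_le.
have cT : continuous T by exact: lipschitz_continuous TC.
have cg : continuous g by move=> z; exact: differentiable_continuous.
have cH : continuous (fun X : 'rV[R]_(n + 1) => H (base X)).
  apply: (@lipschitz_continuous _ _ _ _ CQ) => X Y; apply: le_trans (HC _ _) _.
  by rewrite ler_wpM2l// -baseB; exact: norm_base_le.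
have cf : continuous f.
  move=> X; apply: (continuousB (cH X)).
  apply: (@continuous_comp _ _ _ (fun X => T (base X)) g); last exact: cg.
  by apply: (@continuous_comp _ _ _ (@base R n) T); [exact: cbase|exact: cT].
have mS eta : lebesgue_measurable (S eta).
  have mlt (phi : 'rV[R]_(n + 1) -> R) (a : R) : continuous phi ->
      lebesgue_measurable [set X | phi X < a].
    move=> cphi; have := continuous_lebesgue_measurable cphi
      (@measurableT _ (lebesgue_space R (n + 1))) (measurable_itv `]-oo, a[).
    by rewrite setTI.
  have -> : S eta = ([set X | `|q - base X| < rho / 2] `&`
      [set X | `|height X - p| < K]) `&`
      ([set X | - f X < 0] `\` [set X | - f X < - (c0 * eta)]).
    apply/seteqP; split=> X; rewrite /S/=.
      by move=> [h1 h2 /andP[h3 h4]]; do !split => //; lra.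
    by move=> [[h1 h2] [h3 /negP h4]]; split=> //; lra.
  have cNf : continuous (fun X => - f X) by move=> X; exact: continuousN (cf X).
  apply: measurableI; last by apply: measurableD; exact: mlt.
  apply: measurableI; apply: mlt.
    apply: (@lipschitz_continuous _ _ _ _ 1) => X Y; rewrite mul1r.
    apply: le_trans (norm_subr_lip _ _ _) _; rewrite -baseB; exact: norm_base_le.
  apply: (@lipschitz_continuous _ _ _ _ 1) => X Y; rewrite mul1r.
  apply: le_trans (ler_dist_dist _ _) _.
  have -> : height X - p - (height Y - p) = height (X - Y) by rewrite heightB; ring.
  exact: norm_height_le.
pose rho' := `|q| + rho + `|e| + `|p| + `|K| + 1.
have rho'0 : 0 < rho'.
  by rewrite /rho' ltr_wpDl// !addr_ge0// ltW.
pose V0 := (2 * rho') ^+ (n + 1).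
have V00 : 0 <= V0 by rewrite exprn_ge0// mulr_ge0// ltW.
(* Below rho / 2 the point outside Omega stays in the chart; below 1 / (2 c0) the number N of
   translates satisfies N c0 eta >= 1/2. *)
exists V, (2 * c0 * V0), (Num.min (rho / 2) (2 * c0)^-1); split=> //.
- have cq : continuous (fun x : 'rV[R]_n => `|q - x|).
    apply: (@lipschitz_continuous _ _ _ _ 1) => x y; rewrite mul1r.
    exact: norm_subr_lip.
  have -> : V = (fun x => `|q - x|) @^-1` `]-oo, rho / 2[%classic.
    by apply/seteqP; split=> x; rewrite /= in_itv.
  by apply: open_comp => [x _|]; [exact: cq|exact: interval_open].
- by rewrite /V /= subrr normr0 divr_gt0.
- by rewrite mulr_ge0// mulr_ge0// ltW.
- by rewrite lt_min divr_gt0// invr_gt0 mulr_gt0.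
move=> eta /andP[eta0]; rewrite lt_min => /andP[eta1 eta2].
have t0 : 0 < c0 * eta by exact: mulr_gt0.
have t1 : c0 * eta < 2^-1.
  by move: eta2; rewrite -[(2 * c0)^-1]mul1r ltr_pdivlMr ?mulr_gt0//; lra.
have SD X u : S eta X -> 0 <= u <= 1 -> cube 0 rho' (X + u *: row_e e).
  move=> [h1 h2 _] /andP[u0 u1]; apply: norm_cube; rewrite sub0r normrN.
  apply: (@le_lt_trans _ _ (`|q| + rho + `|e| + `|p| + `|K|)); last by rewrite ltrDl.
  apply: rV_norm_base_height.
    rewrite base_row_e; apply: le_trans (ler_normD _ _) _.
    rewrite normrZ ger0_norm//.
    have : `|base X| <= `|q| + rho.
      rewrite -[base X](subKr q); apply: le_trans (ler_normB _ _) _.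
      by rewrite lerD2l; lra.
    have : u * `|e| <= `|e| by rewrite -[leRHS]mul1r ler_wpM2r.
    have := normr_ge0 p; have := normr_ge0 K; lra.
  rewrite height_row_e -[height X](subrK p); apply: le_trans (ler_normD _ _) _.
  have := ler_norm K; have := normr_ge0 q; have := normr_ge0 e; lra.
pose N := Num.trunc (c0 * eta)^-1.
have iv0 : 0 < (c0 * eta)^-1 by rewrite invr_gt0.
have /andP[N1 N2] := truncn_itv (ltW iv0); rewrite -/N in N1 N2.
have N1' : N%:R * (c0 * eta) <= 1 by rewrite -ler_pdivlMr// mul1r.
have N2' : 1 <= 2 * c0 * eta * N%:R.
  have : 1 < (N%:R + 1) * (c0 * eta) by rewrite -ltr_pdivrMr// div1r natr1.
  by move: t1; lra.
have pack : (N%:R%:E * mu (S eta) <= V0%:E)%E.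
  rewrite -(lebesgue_cube 0 (ltW rho'0)).
  apply: (packing (mS eta) t0 fe) => [X [//]|j X jN SX].
  apply: SD => //; rewrite mulr_ge0 ?ler0n ?(ltW t0)//=.
  by apply: le_trans N1'; rewrite ler_pM2r// ler_nat ltnW.
apply: (@le_trans _ _ (mu (S eta))).
  by apply: le_outer_measure; apply: layerS; rewrite eta0 eta1.
have ce0 : 0 <= 2 * c0 * eta by rewrite !mulr_ge0// ltW.
apply: (@le_trans _ _ ((2 * c0 * eta)%:E * (N%:R%:E * mu (S eta)))%E).
  rewrite muleA -EFinM -[leLHS]mul1e; apply: lee_wpmul2r.
    exact: outer_measure_ge0.
  by rewrite lee_fin.
apply: le_trans (lee_wpmul2l _ pack) _; first by rewrite lee_fin.
by rewrite -EFinM lee_fin mulrAC.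
Qed.

(** Near a point q of Omega itself the distance to the complement stays above dist q / 2, so thinner
    layers are empty there. *)
Lemma layer_local q : closure Omega q ->
  exists (V : set 'rV[R]_n) (C eta0 : R), [/\ open V, V q, 0 <= C, 0 < eta0 &
    forall eta, 0 < eta < eta0 -> (mu (layer V eta) <= (C * eta)%:E)%E].
Proof.
move=> cq; have [Oq|Oq] := pselect (Omega q); last first.
  apply: layer_near_boundary; split=> //.
  by move/interior_subset.
have d0 := dist_open bounded_neqT Omega_open Oq.
pose V := [set x : 'rV[R]_n | `|q - x| < dist q / 2].
exists V, 0, (dist q / 2); split=> //.
- have cont : continuous (fun x : 'rV[R]_n => `|q - x|).
    apply: (@lipschitz_continuous _ _ _ _ 1) => x y; rewrite mul1r.
    exact: norm_subr_lip.
  have -> : V = (fun x => `|q - x|) @^-1` `]-oo, dist q / 2[%classic.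
    by apply/seteqP; split=> x; rewrite /= in_itv.
  by apply: open_comp => [x _|]; [exact: cont|exact: interval_open].
- by rewrite /V /= subrr normr0 divr_gt0.
- by rewrite divr_gt0.
move=> eta /andP[e0 e1]; rewrite mul0r.
have -> : layer V eta = set0.
  apply/seteqP; split=> // X [VX _ dX _].
  have := dist_lip bounded_neqT q (base X); move: VX; rewrite /V/= ler_norml; lra.
by rewrite outer_measure0.
Qed.

(** By compactness finitely many of the local neighbourhoods cover the closure of Omega; their
    constants add up and the least eta0 serves for all. *)
Lemma layer_small : exists (C eta0 : R), [/\ 0 <= C, 0 < eta0 &
  forall eta, 0 < eta < eta0 -> (mu (layer setT eta) <= (C * eta)%:E)%E].
Proof.
have [rho rho0 Orho] := bounded_set_le.
have cO : compact (closure Omega).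
  apply: bounded_closed_compact; last exact: closed_closure.
  exists rho; split; first exact: num_real.
  move=> M rM x cx; apply/ltW; apply: le_lt_trans rM.
  apply: (closure_le _ Orho cx) => y; exact: norm_continuous.
pose P q (t : set 'rV[R]_n * R * R) := closure Omega q ->
  [/\ open t.1.1, t.1.1 q, 0 <= t.1.2, 0 < t.2 &
  forall eta, 0 < eta < t.2 -> (mu (layer t.1.1 eta) <= (t.1.2 * eta)%:E)%E].
have [F FP] : {F & forall q, P q (F q)}.
  apply: (@choice _ _ P) => q; have [cq|ncq] := pselect (closure Omega q); last first.
    by exists (set0, 0, 0) => /ncq.
  by have [V [C [eta0 ?]]] := layer_local cq; exists (V, C, eta0).
move: cO; rewrite compact_cover => /(_ _ (closure Omega) (fun q => (F q).1.1)) cO.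
have [||D DO Dcover] := cO.
- by move=> q /FP [].
- by move=> q cq; exists q => //; have [] := FP q cq.
have finite_layers (l : seq 'rV[R]_n) : {subset l <= closure Omega} ->
    exists (C eta0 : R), [/\ 0 <= C, 0 < eta0 & forall eta, 0 < eta < eta0 ->
      (mu (layer [set x | exists2 q, q \in l & (F q).1.1 x] eta) <= (C * eta)%:E)%E].
  elim: l => [_|q l IH ql].
    exists 0, 1; split=> // eta _; rewrite mul0r.
    have -> : layer [set x | exists2 q, q \in [::] & (F q).1.1 x] eta = set0.
      by apply/seteqP; split=> // X [[]].
    by rewrite outer_measure0.
  have [|C [eta0 [C0 e0 H]]] := IH; first by move=> x xl; apply: ql; rewrite inE xl orbT.
  have [|_ _ C0' e0' H'] := FP q; first by apply/set_mem/ql; rewrite inE eqxx.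
  exists (C + (F q).1.2), (Num.min eta0 (F q).2); split; first exact: addr_ge0.
    by rewrite lt_min e0.
  move=> eta /andP[eta_gt0]; rewrite lt_min => /andP[h1 h2].
  apply: (@le_trans _ _ (mu (layer [set x | exists2 q, q \in l & (F q).1.1 x] eta
      `|` layer (F q).1.1 eta))).
    apply: le_outer_measure => X [[q' q'l Xq'] OX dX hX].
    move: q'l; rewrite inE => /orP[/eqP qq'|q'l]; [right|left]; split=> //.
      by rewrite -qq'.
    by exists q'.
  apply: (le_trans (outer_measureU2 mu _ _)).
  by rewrite mulrDl EFinD; apply: leeD; [apply: H|apply: H']; rewrite eta_gt0.
have [|C [eta0 [C0 e0 H]]] := finite_layers (finmap.enum_fset D).
  by move=> q qD; exact: DO.
exists C, eta0; split=> // eta /H; apply: le_trans; apply: le_outer_measure.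
move=> X [_ OX dX hX]; split=> //.
by have [q qD Xq] := Dcover _ (subset_closure OX); exists q.
Qed.

End boundary_layer.

(** * Decay of the measure of slabs *)

Section null_sets.
Variables (R : realType) (d : nat).
Local Notation mu := (@lebesgue_outer R d).
Implicit Types (A N : set 'rV[R]_d).

Lemma sub_null A N : A `<=` N -> mu N = 0 -> mu A = 0.
Proof.
move=> AN N0; apply/eqP; rewrite eq_le outer_measure_ge0 andbT -N0.
exact: le_outer_measure.
Qed.

Lemma nullU A N : mu A = 0 -> mu N = 0 -> mu (A `|` N) = 0.
Proof.
move=> A0 N0; apply/eqP; rewrite eq_le outer_measure_ge0 andbT.
apply: (@le_trans _ _ (mu A + mu N)%E); first exact: outer_measureU2.
by rewrite A0 N0 adde0.
Qed.

Lemma null_bigcup (F : nat -> set 'rV[R]_d) :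
  (forall k, mu (F k) = 0) -> mu (\bigcup_k F k) = 0.
Proof.
move=> F0; apply/eqP; rewrite eq_le outer_measure_ge0 andbT.
apply: (@le_trans _ _ (\sum_(k <oo) mu (F k))%E).
  exact: outer_measure_sigma_subadditive.
by rewrite eseries0.
Qed.

Lemma null_measurable N : mu N = 0 -> lebesgue_measurable N.
Proof.
move=> N0; apply: le_caratheodory_measurable => A.
change (mu (A `&` N) + mu (A `&` ~` N) <= mu A)%E.
rewrite (sub_null (@subIsetr _ _ _) N0) add0e.
by apply: le_outer_measure; exact: subIsetl.
Qed.

(** Null sets are Caratheodory-measurable, so almost-everywhere statements about arbitrary
    predicates reduce to the outer measure of the exceptional set. *)
Lemma lebesgue_aeP (P : 'rV[R]_d -> Prop) :
  {ae lebesgue R d, forall X, P X} <-> mu [set X | ~ P X] = 0.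
Proof.
split=> [[N [mN N0 PN]]|P0]; first exact: sub_null PN N0.
by exists [set X | ~ P X]; split=> //; exact: null_measurable.
Qed.

End null_sets.

Section interaction_terms.
Variables (R : realType) (d : nat) (s : R).
Local Notation mu := (@lebesgue_outer R d).
Implicit Types (A B E F U : set 'rV[R]_d).

(** Complementation exchanges the last two terms of the perimeter, up to the symmetry of the
    interaction. *)
Lemma perimeterC E U : lebesgue_measurable E -> lebesgue_measurable U ->
  perimeter s (~` E) U = perimeter s E U.
Proof.
move=> mE mU; have mE' : lebesgue_measurable (~` E) by exact: measurableC.
rewrite /perimeter setCK (interactionC s (measurableI _ _ mE' mU) (measurableI _ _ mE mU)).
rewrite (interactionC s (measurableI _ _ mE' mU) (measurableD mE mU)).
rewrite (interactionC s (measurableD mE' mU) (measurableI _ _ mE mU)).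
exact: addeAC.
Qed.

Lemma minimalC E U : lebesgue_measurable E -> lebesgue_measurable U ->
  minimal s E U -> minimal s (~` E) U.
Proof.
move=> mE mU [Pfin Pmin]; rewrite /minimal (perimeterC mE mU); split=> [//|F mF FE].
have mF' : lebesgue_measurable (~` F) by exact: measurableC.
rewrite -(perimeterC mF mU); apply: (Pmin _ mF').
apply/lebesgue_aeP; apply: sub_null ((lebesgue_aeP _).1 FE) => X /= nFE [h1 h2].
apply: nFE; split=> -[h3 h4]; split=> //.
  by apply: contrapT => h5; have [] := h2 (conj h5 h4).
by move=> h5; have [] := h1 (conj h5 h4).
Qed.

End interaction_terms.

(** * Competitors inside the cylinder and the choice of the layer *)

Section slabs.
Variables (R : realType) (n : nat) (s : R).
Hypotheses (n_gt0 : (0 < n)%N) (s_gt0 : 0 < s) (s_lt1 : s < 1).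
Variable Omega : set 'rV[R]_n.
Hypotheses (Omega_open : open Omega) (Omega_bounded : bounded_set Omega)
  (Omega_C11 : C11_boundary Omega).
Local Notation mu := (@lebesgue_outer R (n + 1)).
Local Notation dist := (dist Omega).
Local Notation cyl := (cylinder Omega setT).
Implicit Types (E A B : set 'rV[R]_(n + 1)) (X Y : 'rV[R]_(n + 1)).

Let OT : exists y, ~ Omega y := bounded_neqT n_gt0 Omega_bounded.

Definition bdist X : R := dist (base X).

Lemma bdist_lip X Y : `|bdist X - bdist Y| <= `|X - Y|.
Proof.
by apply: le_trans (dist_lip OT _ _) _; rewrite -baseB; exact: norm_base_le.
Qed.

Definition hdist (p : R) X : R := `|p - height X|.

Lemma hdist_lip p X Y : `|hdist p X - hdist p Y| <= `|X - Y|.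
Proof.
apply: le_trans (norm_subr_lip _ _ _) _; rewrite -heightB; exact: norm_height_le.
Qed.

Lemma cyl_measurable : lebesgue_measurable cyl.
Proof.
have -> : cyl = ~` [set X | bdist X <= 0].
  apply/seteqP; split=> X; rewrite /cylinder/=.
    by move=> [OX _]; apply/negP; rewrite -ltNge; exact: dist_open.
  by move=> /negP; rewrite -ltNge => /dist_gt0_in.
have -> : [set X | bdist X <= 0] = ~` [set X | 0 < bdist X].
  by apply/seteqP; split=> X /=; rewrite leNgt => /negP.
rewrite setCK; have -> : [set X | 0 < bdist X] = [set X | - bdist X < 0].
  by apply/seteqP; split=> X /=; rewrite oppr_lt0.
apply: (@sublevel_measurable _ _ (fun X => - bdist X)) => X Y.
by rewrite -opprD normrN; exact: bdist_lip.
Qed.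

(** The consequence of minimality on which the decay estimates rest, in a form that treats E and its
    complement alike. *)
Definition one_sided_minimal E := forall U, open U -> compactly_contained U cyl ->
  forall A, lebesgue_measurable A -> A `<=` E `&` U ->
    (interaction s A (~` E) <= interaction s (E `\` A) A)%E.

Lemma locally_minimal_one_sided E : lebesgue_measurable E ->
  locally_minimal s E cyl -> one_sided_minimal E /\ one_sided_minimal (~` E).
Proof.
move=> mE Emin; have mE' : lebesgue_measurable (~` E) by exact: measurableC.
split=> U oU cU A mA AEU; have mU := open_lebesgue_measurable oU.
  exact: (minimal_comparison mE mU mA AEU (Emin U oU cU)).
exact: (minimal_comparison mE' mU mA AEU (minimalC mE mU (Emin U oU cU))).
Qed.

Definition inner_box (p K delta : R) : set 'rV[R]_(n + 1) :=
  [set X | delta < bdist X /\ hdist p X < K].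

Lemma inner_box_compactly p K delta : 0 < delta ->
  open (inner_box p K delta) /\ compactly_contained (inner_box p K delta) cyl.
Proof.
move=> d0; have cb := lip1_continuous bdist_lip; have ch := lip1_continuous (hdist_lip p).
have [rho rho0 Orho] := bounded_set_le Omega_bounded.
split.
  have -> : inner_box p K delta = (bdist @^-1` `]delta, +oo[%classic) `&`
      (hdist p @^-1` `]-oo, K[%classic).
    by apply/seteqP; split=> X; rewrite /inner_box /= !in_itv/= andbT.
  apply: openI; apply: open_comp => [X _|].
  - exact: cb.
  - exact: interval_open.
  - exact: ch.
  - exact: interval_open.
have cl : closure (inner_box p K delta) `<=` [set X | delta <= bdist X /\ hdist p X <= K].
  move=> X cX; split; last by apply: (closure_le ch _ cX) => Y [_ /ltW].
  rewrite -lerN2; apply: (closure_le (f := fun X => - bdist X) _ _ cX).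
    by move=> Y; exact: continuousN (cb Y).
  by move=> Y [h _]; rewrite lerN2 ltW.
split; last first.
  move=> X /cl [h _]; split=> //; apply: dist_gt0_in; exact: lt_le_trans d0 h.
apply: bounded_closed_compact; last exact: closed_closure.
exists (rho + `|p| + `|K|); split; first exact: num_real.
move=> M MK X /cl [h1 h2]; apply/ltW; apply: le_lt_trans MK.
have Xr : `|base X| <= rho.
  apply: Orho; apply: dist_gt0_in; exact: lt_le_trans d0 h1.
apply: rV_norm_base_height.
  by apply: le_trans Xr _; rewrite -addrA lerDl addr_ge0.
rewrite -[height X](subKr p); apply: le_trans (ler_normB _ _) _.
by rewrite -addrA ler_wpDl ?(ltW rho0)// lerD2l; apply: le_trans h2 (ler_norm _).
Qed.

Lemma layerE (p K eta : R) :
  layer Omega p K setT eta = cyl `&` [set X | hdist p X < K] `&` [set X | bdist X < eta].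
Proof.
apply/seteqP; split=> X.
  by move=> [_ OX dX hX]; do !split=> //; rewrite /hdist /= distrC.
by move=> [[[OX _] hX] dX]; split=> //; move: hX; rewrite /hdist /= distrC.
Qed.

(** If no delta in ]0, eta] worked, averaging with phi = [bdist] would give eps <= Csh eta^(-s) C
    eta, that is eps <= Csh C eta^(1-s), which fails for small eta because s < 1. *)
Lemma layer_interaction_small (p K eps : R) : 0 < eps ->
  exists delta, [/\ 0 < delta, (mu (layer Omega p K setT delta) <= eps%:E)%E &
    (interaction s (layer Omega p K setT delta) [set X | (delta <= bdist X)%R] <= eps%:E)%E].
Proof.
move=> eps0.
have [C [eta0 [C0 eta00 H]]] := layer_small n_gt0 Omega_open Omega_bounded Omega_C11 p K.
have Csh0 := shell_const_gt0 (n + 1) s_gt0 s_lt1.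
set Csh := shell_const (n + 1) s in Csh0.
have s1 : 0 < 1 - s by rewrite subr_gt0.
pose t := eps / (2 * (Csh * C + 1)).
have t0 : 0 < t by rewrite divr_gt0// mulr_gt0// ltr_wpDl// mulr_ge0// ltW.
(* In this order: the linear layer bound is valid, the layer has measure at most eps, and eta^(1-s)
   <= t, where t is chosen so that Csh C t < eps. *)
pose eta := Num.min (eta0 / 2) (Num.min (eps / (C + 1)) (t `^ (1 - s)^-1)).
have C1 : 0 < C + 1 by rewrite ltr_wpDl.
have eta_gt0 : 0 < eta by rewrite !lt_min !divr_gt0//= powR_gt0.
have eta_eta0 : eta < eta0.
  by apply: (@le_lt_trans _ _ (eta0 / 2)); [rewrite ge_min lexx|lra].
have eta_eps : C * eta <= eps.
  have : eta <= eps / (C + 1) by rewrite !ge_min lexx !orbT.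
  by rewrite ler_pdivlMr//; move: eta_gt0; nra.
have eta_pow : eta `^ (1 - s) <= t.
  apply: (@le_trans _ _ ((t `^ (1 - s)^-1) `^ (1 - s))).
    apply: ge0_ler_powR; rewrite ?nnegrE ?powR_ge0// ?(ltW s1)// ?(ltW eta_gt0)//.
    by rewrite !ge_min lexx !orbT.
  by rewrite -powRrM mulVf ?gt_eqF// powRr1// ltW.
apply: contrapT => /forallNP nex.
have mS : lebesgue_measurable (cyl `&` [set X | hdist p X < K]).
  apply: measurableI; first exact: cyl_measurable.
  exact: (sublevel_measurable (hdist_lip p)).
have key := interaction_sublevel_average s_gt0 s_lt1 bdist_lip mS (ltW eps0) eta_gt0.
have {key} : (eps%:E <= (Csh * (eta - 0) `^ (- s))%:E *
    mu (cyl `&` [set X | (hdist p X < K)%R] `&` [set X | (bdist X < eta)%R]))%E.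
  apply: key => delta /andP[delta0 delta1]; rewrite -layerE leNgt; apply/negP => lt.
  apply: (nex delta); split=> //; last exact: ltW.
  apply: (le_trans (H delta _)); first by rewrite delta0 (le_lt_trans delta1).
  by rewrite lee_fin; apply: le_trans eta_eps; rewrite ler_wpM2l.
rewrite subr0 -layerE; apply/negP; rewrite -ltNge.
apply: (@le_lt_trans _ _ ((Csh * eta `^ (- s))%:E * (C * eta)%:E)%E).
  apply: lee_wpmul2l; first by rewrite lee_fin mulr_ge0 ?powR_ge0// ltW.
  by apply: H; rewrite eta_gt0.
rewrite -EFinM lte_fin.
have -> : Csh * eta `^ (- s) * (C * eta) = Csh * C * eta `^ (1 - s).
  have -> : eta `^ (1 - s) = eta `^ (- s) * eta.
    rewrite -{3}(powRr1 (ltW eta_gt0)) -powRD; last by apply/implyP => _; rewrite gt_eqF.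
    by rewrite addrC.
  by ring.
have CC0 : 0 <= Csh * C by rewrite mulr_ge0// ltW.
apply: (@le_lt_trans _ _ (Csh * C * t)); first by rewrite ler_wpM2l.
have -> : eps = t * (2 * (Csh * C + 1)).
  by rewrite /t mulfVK// gt_eqF// mulr_gt0// ltr_wpDl.
by move: t0 CC0; nra.
Qed.

End slabs.

Lemma interactionUr_le (R : realType) (d : nat) (s : R) (A B1 B2 : set 'rV[R]_d) :
  lebesgue_measurable A -> lebesgue_measurable B1 -> lebesgue_measurable B2 ->
  (interaction s A (B1 `|` B2) <= interaction s A B1 + interaction s A B2)%E.
Proof.
move=> mA mB1 mB2; have mD := measurableD mB2 mB1.
have -> : B1 `|` B2 = B1 `|` (B2 `\` B1).
  apply/seteqP; split=> X [X1|]; [by left| |by left|by move=> []; right].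
  by move=> X2; have [X1|X1] := pselect (B1 X); [left|right].
rewrite (interactionUr s mA mB1 mD); last first.
  by apply/seteqP; split=> // X [? []].
apply: leeD; first exact: lexx.
exact: (le_interaction s mA mA mD mB2 (@subset_refl _ _) (@subDsetl _ _ _)).
Qed.

(** * The decay estimate between two slabs *)

Section slab_decay.
Variables (R : realType) (n : nat) (s : R).
Hypotheses (n_gt0 : (0 < n)%N) (s_gt0 : 0 < s) (s_lt1 : s < 1).
Variable Omega : set 'rV[R]_n.
Hypotheses (Omega_open : open Omega) (Omega_bounded : bounded_set Omega)
  (Omega_C11 : C11_boundary Omega).
Variables (rho : R) (rho_gt0 : 0 < rho).
Hypothesis Omega_rho : forall x, Omega x -> `|x| < rho.
Local Notation mu := (@lebesgue_outer R (n + 1)).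
Local Notation dist := (dist Omega).
Local Notation cyl := (cylinder Omega setT).
Implicit Types (E A B : set 'rV[R]_(n + 1)) (X Y : 'rV[R]_(n + 1)).

Let d_gt0 : (0 < n + 1)%N. Proof. by rewrite addn1. Qed.

Definition slab E (p K : R) := (E `&` cyl) `&` [set X | hdist p X < K].

Lemma slab_measurable E p K : lebesgue_measurable E -> lebesgue_measurable (slab E p K).
Proof.
move=> mE; apply: measurableI; last exact: (sublevel_measurable (hdist_lip p)).
by apply: measurableI => //; exact: cyl_measurable.
Qed.

Lemma slab_volume E p K : 0 <= K ->
  (mu (slab E p K) <= ((2 * rho) ^+ n * (2 * K))%:E)%E.
Proof.
move=> K0; pose Q : 'rV[R]_(n + 1) * 'rV[R]_(n + 1) :=
  (row_mx (const_mx (- rho)) (const_mx (p - K)), row_mx (const_mx rho) (const_mx (p + K))).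
have -> : (2 * rho) ^+ n * (2 * K) = box_volume Q.
  rewrite /box_volume big_split_ord/= big_ord_recl big_ord0 mulr1.
  rewrite !row_mxEr !mxE max_r; last lra.
  congr (_ * _); last ring.
  rewrite (eq_bigr (fun=> 2 * rho)) ?prodr_const ?card_ord// => i _.
  by rewrite !row_mxEl !mxE max_r; [ring|move: rho_gt0; lra].
rewrite -lebesgue_box; apply: le_outer_measure => X [[_ [OX _]] hX] i.
rewrite -[X]hsubmxK -/(base X) /Q/=; case: (splitP i) => j ij.
  have -> : i = lshift 1 j by exact/val_inj.
  have := le_lt_trans (rV_coord_le (base X) j) (Omega_rho OX).
  by rewrite !row_mxEl !mxE ltr_norml; lra.
have -> : i = rshift n j by exact/val_inj.
rewrite (ord1 j) !row_mxEr -/(height X) !mxE.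
by move: hX; rewrite /hdist /= ltr_norml /height mxE; lra.
Qed.

(** In the first coordinate Omega has width at most 2 rho <= r, half the side of the cube. *)
Lemma slab_cube_volume E p K X r : 2 * rho <= r ->
  (mu (slab E p K `&` cube X r) <= ((2 * r) ^+ (n + 1) / 2)%:E)%E.
Proof.
move=> r_ge; have r0 : 0 < r by move: rho_gt0; lra.
pose i0 : 'I_(n + 1) := lshift 1 (Ordinal n_gt0).
pose Q := (setcoord (X - const_mx r) i0 (- rho), setcoord (X + const_mx r) i0 rho).
apply: (@le_trans _ _ (mu (box Q))).
  apply: le_outer_measure => Y [[[_ [OY _]] _] YX] i.
  have := YX i; rewrite /Q/= !mxE; case: eqVneq => [->|] // _.
  have := le_lt_trans (rV_coord_le (base Y) (Ordinal n_gt0)) (Omega_rho OY).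
  by rewrite baseE ltr_norml => /andP[-> /ltW].
rewrite lebesgue_box lee_fin /box_volume (bigD1 i0)//= !mxE eqxx.
rewrite (eq_bigr (fun=> 2 * r)); last first.
  by move=> i /negPf ii; rewrite !mxE ii max_r; [ring|lra].
rewrite prodr_const cardC1 card_ord addn1 /= max_r; last by move: rho_gt0; lra.
rewrite exprS; have : 0 < (2 * r) ^+ n by rewrite exprn_gt0// mulr_gt0.
by move: r_ge; nra.
Qed.

(* This set is null when E lies below the graph of v outside the cylinder and
   p is large. *)
Definition side_trace E (p K r : R) : set 'rV[R]_(n + 1) :=
  E `&` [set X | [/\ `|base X| <= r, ~ Omega (base X) & hdist p X < K]].

(** For A the slab without its layer, kappa |A| <= L_s(A, E^c) + L_s(A, E \ A) <= 2 L_s(A, E \ A).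
    The horizontally far part of E \ A costs at most nu |A|; as 4 nu <= kappa, twice this is at most
    half of the left side. The rest yields kappa / 4 as the layer error tends to 0. *)
Lemma slab_interaction_ge E p K r R0 : lebesgue_measurable E ->
  one_sided_minimal s Omega E -> 0 < r -> 0 < R0 ->
  4 * (far_const (n + 1) s * R0 `^ (- s)) <= isop_const (n + 1) s * r `^ (- s) ->
  mu (side_trace E p K (rho + R0)) = 0 ->
  (forall X, (mu (slab E p K `&` cube X r) <= ((2 * r) ^+ (n + 1) / 2)%:E)%E) ->
  ((isop_const (n + 1) s * r `^ (- s) / 4)%:E * mu (slab E p K) <=
   interaction s (slab E p K) [set X | (K <= hdist p X)%R])%E.
Proof.
move=> mE Emin r0 R00.
set kappa := isop_const _ _ * _; set nu := far_const _ _ * _ => nukappa trace0 small.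
have kappa0 : 0 < kappa by rewrite mulr_gt0 ?powR_gt0// isop_const_gt0.
have nu0 : 0 <= nu by rewrite mulr_ge0 ?powR_ge0// ltW// far_const_gt0.
set A := slab E p K; have mA : lebesgue_measurable A by exact: slab_measurable.
pose top : set 'rV[R]_(n + 1) := [set X | K <= hdist p X].
have mtop : lebesgue_measurable top by exact: (superlevel_measurable (hdist_lip p)).
rewrite -/top; set tau := interaction s A top.
have tau0 : (0 <= tau)%E by exact: interaction_ge0.
have [m mAE] : exists m : R, mu A = m%:E.
  exists (fine (mu A)); rewrite fineK// ge0_fin_numE; last exact: outer_measure_ge0.
  have [K0|K0] := leP 0 K.
    by apply: le_lt_trans (slab_volume _ _ K0) _; rewrite ltry.
  have -> : A = set0; last by rewrite outer_measure0.
  apply/seteqP; split=> // X [_]; rewrite /hdist/= => /lt_trans /(_ K0).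
  by rewrite normr_lt0.
have m0 : 0 <= m by rewrite -lee_fin -mAE; exact: outer_measure_ge0.
pose N1 := side_trace E p K (rho + R0).
have mN1 : lebesgue_measurable N1 by exact: null_measurable.
have mE' : lebesgue_measurable (~` E) by exact: measurableC.
(* The base of a point of [N2] lies outside Omega and beyond the ball of radius rho + R0, hence at
   distance at least R0 from the bases of the slab. *)
pose N2 := ((E `\` A) `\` top) `\` N1.
have mN2 : lebesgue_measurable N2.
  by apply: measurableD => //; apply: measurableD => //; exact: measurableD.
have key (eps : R) : 0 < eps ->
    ((kappa * m)%:E <= (tau + (nu * m + eps)%:E) + (tau + (nu * m + eps)%:E)
      + (kappa * eps)%:E)%E.
  move=> eps0.
  have [delta [delta0 layer_mu layer_int]] := layer_interaction_small n_gt0 s_gt0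
    s_lt1 Omega_open Omega_bounded Omega_C11 p K eps0.
  set L := layer Omega p K setT delta in layer_mu layer_int.
  pose deep : set 'rV[R]_(n + 1) := [set X | delta <= bdist Omega X].
  have blip := bdist_lip n_gt0 Omega_bounded.
  have mdeep : lebesgue_measurable deep by exact: (superlevel_measurable blip).
  have mL : lebesgue_measurable L.
    rewrite /L layerE; apply: measurableI; last exact: (sublevel_measurable blip).
    apply: measurableI; first exact: cyl_measurable.
    exact: (sublevel_measurable (hdist_lip p)).
  pose Ad := A `&` deep.
  have AdA : Ad `<=` A by move=> X [].
  have mAd : lebesgue_measurable Ad by exact: measurableI.
  have mEAd : lebesgue_measurable (E `\` Ad) by exact: measurableD.
  (* The bound is delta / 2 because [deep] allows [bdist] to equal delta, whereas [inner_box] asks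
     for a strict inequality. *)
  have [oU cU] := inner_box_compactly n_gt0 Omega_bounded p K (divr_gt0 delta0 (ltr0Sn R 1)).
  have AdU : Ad `<=` E `&` inner_box Omega p K (delta / 2).
    move=> X [[[EX _] hX] dX]; split=> //; split=> //.
    by apply: lt_le_trans dX; lra.
  have cmp := Emin _ oU cU _ mAd AdU.
  have AdL : A `<=` Ad `|` L.
    move=> X AX; have [dX|dX] := leP delta (bdist Omega X); [left|right] => //.
    by rewrite /L layerE; case: AX => -[].
  have x_le : (interaction s Ad (E `\` Ad) <= tau + (nu * m + eps)%:E)%E.
    have mtN := measurableU _ _ mtop mN1; have mNL := measurableU _ _ mN2 mL.
    apply: (@le_trans _ _ (interaction s Ad ((top `|` N1) `|` (N2 `|` L)))).
      apply: le_interaction => //; first exact: measurableU.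
      move=> X [EX nAd].
      have [tX|tX] := pselect (top X); first by left; left.
      have [N1X|N1X] := pselect (N1 X); first by left; right.
      have [AX|AX] := pselect (A X); last by right; left.
      by right; right; case: (AdL _ AX).
    apply: le_trans (interactionUr_le s mAd mtN mNL) _.
    have h1 : (interaction s Ad (top `|` N1) <= tau)%E.
      apply: le_trans (interactionUr_le s mAd mtop mN1) _.
      rewrite (interactionC s mAd mN1) (interaction_null s mN1 mAd trace0) adde0.
      exact: le_interaction.
    apply: leeD => //; rewrite EFinD.
    apply: le_trans (interactionUr_le s mAd mN2 mL) _; apply: leeD.
      rewrite EFinM -mAE; apply: (@le_trans _ _ (nu%:E * mu Ad)%E); last first.
        by apply: lee_wpmul2l; [rewrite lee_fin|exact: le_outer_measure].
      apply: interaction_le => // X [[[_ [OX _]] _] _].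
      apply: le_trans (potential_far s_gt0 X R00).
      have mC : lebesgue_measurable (~` cube X R0).
        by apply: measurableC; exact: cube_measurable.
      apply: (ge0_subset_integral (lebesgue R (n + 1)) mN2 mC).
      - exact: ekernel_measurable.
      - by move=> Y _; rewrite lee_fin kernel_ge0.
      move=> Y [[[EY AY] tY] N1Y] /(cube_norm (ltW R00)) XY.
      have hY : hdist p Y < K by rewrite ltNge; apply/negP.
      have OY : ~ Omega (base Y) by move=> OY; apply: AY.
      apply: N1Y; split=> //; split=> //.
      rewrite -[base Y](subKr (base X)); apply: le_trans (ler_normB _ _) _.
      apply: lerD; first exact/ltW/Omega_rho.
      by apply: le_trans XY; rewrite -baseB; exact: norm_base_le.
    rewrite (interactionC s mAd mL); apply: le_trans layer_int.
    by apply: le_interaction => // X [].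
  have iso : (kappa%:E * mu Ad <= interaction s Ad (~` Ad))%E.
    apply: interaction_setC_ge => // X AdX; apply: le_trans (small X).
    by apply: le_outer_measure => Y [/AdA].
  have split_int : interaction s Ad (~` Ad) =
      (interaction s Ad (~` E) + interaction s Ad (E `\` Ad))%E.
    rewrite -(interactionUr s mAd mE' mEAd).
      congr interaction; apply/seteqP; split=> X.
        by move=> AdX; have [EX|EX] := pselect (E X); [right|left].
      by case=> [EX /AdU[]|[]].
    by apply/seteqP; split=> // X [EX []].
  have muA : (mu A <= mu Ad + eps%:E)%E.
    apply: (@le_trans _ _ (mu Ad + mu L)%E); last exact: leeD.
    apply: le_trans (outer_measureU2 mu _ _); exact: le_outer_measure.
  rewrite EFinM -mAE; apply: (@le_trans _ _ (kappa%:E * (mu Ad + eps%:E))%E).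
    by apply: lee_wpmul2l => //; rewrite lee_fin ltW.
  have eps0' : (0 <= eps%:E)%E by rewrite lee_fin ltW.
  rewrite (ge0_muleDr _ (outer_measure_ge0 mu Ad) eps0').
  apply: (leeD _ (lexx _)); apply: le_trans iso _; rewrite split_int.
  apply: (leeD _ x_le); apply: le_trans cmp _.
  by rewrite (interactionC s mEAd mAd).
rewrite mAE -EFinM; case: tau tau0 key => [t| |]// t0 key; last by rewrite leey.
rewrite lee_fin leNgt; apply/negP => gap.
have g0 : 0 < kappa / 4 * m - t by lra.
have k2 : 0 < 2 + kappa by lra.
(* The total coefficient of eps in [key] is 2 + kappa, so the errors add up to exactly the gap. *)
have := key ((kappa / 4 * m - t) / (2 + kappa)) (divr_gt0 g0 k2).
set eps := _ / _.
have epsE : eps * (2 + kappa) = kappa / 4 * m - t by rewrite mulfVK// gt_eqF.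
rewrite -!EFinD lee_fin.
by have := ler_wpM2r m0 nukappa; move: epsE gap; clearbody eps kappa nu; lra.
Qed.

Definition decay_const : R := 4 * shell_const (n + 1) s / isop_const (n + 1) s.

Lemma decay_const_gt0 : 0 < decay_const.
Proof.
by rewrite divr_gt0 ?isop_const_gt0// mulr_gt0// shell_const_gt0.
Qed.

(* Average [slab_interaction_ge] over the half-height in (K1, K2]. *)
Lemma slab_decay E p K1 K2 r R0 : lebesgue_measurable E ->
  one_sided_minimal s Omega E -> 0 < r -> 0 < R0 -> K1 < K2 ->
  4 * (far_const (n + 1) s * R0 `^ (- s)) <= isop_const (n + 1) s * r `^ (- s) ->
  mu (side_trace E p K2 (rho + R0)) = 0 ->
  (forall X, (mu (slab E p K2 `&` cube X r) <= ((2 * r) ^+ (n + 1) / 2)%:E)%E) ->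
  (mu (slab E p K1) <= (decay_const * (r / (K2 - K1)) `^ s)%:E * mu (slab E p K2))%E.
Proof.
move=> mE Emin r0 R00 K12 nukappa trace0 small.
set kappa := isop_const _ _ * _ in nukappa.
have kappa0 : 0 < kappa by rewrite mulr_gt0 ?powR_gt0// isop_const_gt0.
have slabS K K' : K <= K' -> slab E p K `<=` slab E p K'.
  by move=> KK X [EX hX]; split=> //; exact: lt_le_trans hX KK.
have fin K : mu (slab E p K) \is a fin_num.
  rewrite ge0_fin_numE; last exact: outer_measure_ge0.
  apply: le_lt_trans (le_outer_measure mu _ _ (slabS K (Num.max 0 K) _)) _.
    by rewrite le_max lexx orbT.
  by apply: le_lt_trans (slab_volume _ _ _) _; rewrite ?ltry// le_max lexx.
pose c := kappa / 4 * fine (mu (slab E p K1)).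
have cE : c%:E = ((kappa / 4)%:E * mu (slab E p K1))%E by rewrite EFinM fineK.
have c0 : 0 <= c.
  by rewrite mulr_ge0 ?divr_ge0 ?(ltW kappa0)// fine_ge0// outer_measure_ge0.
have mEc : lebesgue_measurable (E `&` cyl).
  by apply: measurableI => //; exact: cyl_measurable.
have := interaction_sublevel_average s_gt0 s_lt1 (hdist_lip p) mEc c0 K12.
have k4 : (0 <= (kappa / 4)%:E)%E by rewrite lee_fin divr_ge0// ltW.
move=> avg; have {avg} : (c%:E <= (shell_const (n + 1) s * (K2 - K1) `^ (- s))%:E *
    mu (slab E p K2))%E.
  apply: avg => K /andP[/ltW K1K KK2].
  apply: (@le_trans _ _ ((kappa / 4)%:E * mu (slab E p K))%E).
    by rewrite cE; apply: lee_wpmul2l => //; apply: le_outer_measure; exact: slabS.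
  apply: (slab_interaction_ge mE Emin r0 R00 nukappa).
    apply: sub_null trace0 => X [EX [bX OX hX]]; split=> //; split=> //.
    exact: lt_le_trans hX KK2.
  move=> X; apply: le_trans (small X); apply: le_outer_measure; apply: setSI.
  exact: slabS.
rewrite -(fineK (fin K1)) -(fineK (fin K2)) -!EFinM !lee_fin /c.
set a1 := fine _; set a2 := fine _ => H.
have h0 : 0 < K2 - K1 by rewrite subr_gt0.
have -> : a1 = 4 / kappa * (kappa / 4 * a1).
  by field; rewrite gt_eqF.
have -> : decay_const * (r / (K2 - K1)) `^ s * a2 =
    4 / kappa * (shell_const (n + 1) s * (K2 - K1) `^ (- s) * a2).
  rewrite /decay_const /kappa powRM ?invr_ge0 ?(ltW r0) ?(ltW h0)//.
  rewrite -[(K2 - K1)^-1]powR_inv1 ?(ltW h0)// -powRrM mulN1r powRN.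
  have u0 : r `^ s != 0 by rewrite gt_eqF// powR_gt0.
  have v0 := lt0r_neq0 (isop_const_gt0 s d_gt0).
  have w0 : (K2 - K1) `^ s != 0 by rewrite gt_eqF// powR_gt0.
  rewrite powRN; move: u0 v0 w0.
  move: (r `^ s) (isop_const _ _) ((K2 - K1) `^ s) => u v w u0 v0 w0.
  by field; rewrite u0 v0 w0.
by rewrite ler_wpM2l// divr_ge0// ltW.
Qed.

End slab_decay.

(** * Vanishing of unit slabs by iteration *)

Section slab_vanishes.
Variables (R : realType) (n : nat) (s : R).
Hypotheses (n_gt0 : (0 < n)%N) (s_gt0 : 0 < s) (s_lt1 : s < 1).
Variable Omega : set 'rV[R]_n.
Hypotheses (Omega_open : open Omega) (Omega_bounded : bounded_set Omega)
  (Omega_C11 : C11_boundary Omega).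
Variables (rho : R) (rho_gt0 : 0 < rho).
Hypothesis Omega_rho : forall x, Omega x -> `|x| < rho.
Local Notation mu := (@lebesgue_outer R (n + 1)).
Local Notation cyl := (cylinder Omega setT).
Local Notation side_trace := (side_trace Omega).
Local Notation slab := (slab Omega).
Local Notation d := (n + 1)%N.
Implicit Types (E A B : set 'rV[R]_(n + 1)) (X Y : 'rV[R]_(n + 1)).

Let d_gt0 : (0 < d)%N. Proof. by rewrite addn1. Qed.

Let powR_surj (c : R) : 0 < c -> exists2 t : R, 0 < t & t `^ s = c.
Proof.
move=> c0; exists (c `^ s^-1); first exact: powR_gt0.
by rewrite -powRrM mulVf ?gt_eqF// powRr1// ltW.
Qed.

Let ler_powRs (a b : R) : 0 <= a -> a <= b -> a `^ s <= b `^ s.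
Proof.
by move=> a0 ab; apply: ge0_ler_powR; rewrite ?nnegrE ?(ltW s_gt0)// (le_trans a0).
Qed.

Let subslab E p K K' : K <= K' -> (mu (slab E p K) <= mu (slab E p K'))%E.
Proof.
by move=> KK; apply: le_outer_measure => X [EX hX]; split=> //; exact: lt_le_trans hX KK.
Qed.

Let sub_trace E p K K' r : K <= K' -> mu (side_trace E p K' r) = 0 ->
  mu (side_trace E p K r) = 0.
Proof.
move=> KK; apply: sub_null => X [EX [bX OX hX]]; split=> //; split=> //.
exact: lt_le_trans hX KK.
Qed.

Lemma slab_null : exists R0 Kmax : R, [/\ 0 < R0, 0 < Kmax &
  forall E p, lebesgue_measurable E -> one_sided_minimal s Omega E ->
    mu (side_trace E p Kmax (rho + R0)) = 0 -> mu (slab E p 1) = 0].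
Proof.
pose D := decay_const n s.
have D0 : 0 < D by exact: decay_const_gt0.
have far0 := far_const_gt0 d s_gt0.
have iso0 := isop_const_gt0 s d_gt0.
pose r0 := 2 * rho; have r00 : 0 < r0 by rewrite mulr_gt0.
(* With this [tR] the absorption condition is an equality at r = r0; a smaller r only increases its
   right side, so one R0 serves all scales. *)
have [tR tR0 tRE] : exists2 t : R, 0 < t & t `^ s = 4 * far_const d s / isop_const d s.
  by apply: powR_surj; rewrite divr_gt0// mulr_gt0.
pose R0 := r0 * tR; have R00 : 0 < R0 by rewrite mulr_gt0.
have farR0 r : 0 < r -> r <= r0 ->
    4 * (far_const d s * R0 `^ (- s)) <= isop_const d s * r `^ (- s).
  move=> r_gt0 rr0; apply: (@le_trans _ _ (isop_const d s * r0 `^ (- s))).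
    rewrite !powRN (powRM _ (ltW r00) (ltW tR0)) tRE.
    have w0 : r0 `^ s != 0 by rewrite gt_eqF// powR_gt0.
    have u0 := lt0r_neq0 far0; have v0 := lt0r_neq0 iso0.
    rewrite le_eqVlt; apply/orP; left; apply/eqP; move: w0 u0 v0.
    move: (r0 `^ s) (far_const _ _) (isop_const _ _) => w u v w0 u0 v0.
    by field; rewrite w0 u0 v0.
  rewrite ler_pM2l// !powRN lef_pV2 ?posrE ?powR_gt0//.
  by apply: ler_powRs => //; exact: ltW.
have [tH tH0 tHE] : exists2 t : R, 0 < t & t `^ s = (4 * D)^-1.
  by apply: powR_surj; rewrite invr_gt0 mulr_gt0.
(* A step of length H at scale r0 gains a factor 1/4; H >= 2 lets the second iteration start at
   half-height 2. *)
pose H := Num.max 2 (r0 / tH).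
have H0 : 0 < H by rewrite lt_max ltr0Sn.
have H2 : 2 <= H by rewrite le_max lexx.
have DH : D * (r0 / H) `^ s <= 4^-1.
  have : (r0 / H) `^ s <= (4 * D)^-1.
    rewrite -tHE; apply: ler_powRs; first by rewrite divr_ge0// ltW.
    by rewrite ler_pdivrMr// mulrC -ler_pdivrMr// /H le_max lexx orbT.
  by rewrite invfM ler_pdivlMr// mulrC.
have [t1 t10 t1E] : exists2 t : R, 0 < t & t `^ s = (2 ^+ d * D)^-1.
  by apply: powR_surj; rewrite invr_gt0 mulr_gt0// exprn_gt0.
(* Chosen so that the decay factor D (2 r1)^s of the second iteration is at most 2^(-d). *)
pose r1 := Num.min r0 (t1 / 2).
have r10 : 0 < r1 by rewrite lt_min r00 divr_gt0.
have r1r0 : r1 <= r0 by rewrite ge_min lexx.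
have D1 : D * (2 * r1) `^ s <= (2 ^+ d)^-1.
  have : (2 * r1) `^ s <= (2 ^+ d * D)^-1.
    rewrite -t1E; apply: ler_powRs; first by rewrite mulr_ge0// ltW.
    by rewrite mulrC -ler_pdivlMr// /r1 ge_min lexx orbT.
  by rewrite invfM ler_pdivlMr// mulrC.
pose eps1 := (2 * r1) ^+ d / 2.
have eps10 : 0 < eps1 by rewrite divr_gt0// exprn_gt0// mulr_gt0.
pose V := (2 * rho) ^+ n * (2 * H).
have V0 : 0 < V by rewrite mulr_gt0 ?exprn_gt0// mulr_gt0.
(* The largest slab has volume at most (N + 1) V, and N + 1 <= 2^N, so the gain 4^(-N) leaves V /
   2^N < eps1. *)
pose N := Num.bound (V / eps1).
have NV : V / 2 ^+ N < eps1.
  by rewrite ltr_pdivrMr ?exprn_gt0// mulrC -ltr_pdivrMr// upper_nthrootP.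
exists R0, (N.+1%:R * H); split=> //; first by rewrite mulr_gt0.
move=> E p mE Emin trace0.
have decay1 (j : nat) : (j <= N)%N ->
    (mu (slab E p H) <= (4^-1 ^+ j)%:E * mu (slab E p (j.+1%:R * H)))%E.
  elim: j => [_|j IH jN]; first by rewrite expr0 mul1e mul1r.
  apply: (le_trans (IH (ltnW jN))); rewrite exprSr EFinM -muleA.
  apply: lee_wpmul2l; first by rewrite lee_fin exprn_ge0// invr_ge0.
  have jj : j.+1%:R * H < j.+2%:R * H by rewrite ltr_pM2r// ltr_nat.
  have tr : mu (side_trace E p (j.+2%:R * H) (rho + R0)) = 0.
    by apply: sub_trace trace0; rewrite ler_pM2r// ler_nat.
  apply: (le_trans (slab_decay n_gt0 s_gt0 s_lt1 Omega_open Omega_bounded Omega_C11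
    rho_gt0 Omega_rho mE Emin r00 R00 jj (farR0 _ r00 (lexx _)) tr _)).
    by move=> X; apply: (slab_cube_volume n_gt0 rho_gt0 Omega_rho); exact: lexx.
  apply: lee_wpmul2r; first exact: outer_measure_ge0.
  have -> : j.+2%:R * H - j.+1%:R * H = H by rewrite -mulrBl -natrB// subSnn mul1r.
  by rewrite lee_fin.
have a0 : (mu (slab E p H) <= eps1%:E)%E.
  apply: (le_trans (decay1 N (leqnn _))).
  have K0 : 0 <= N.+1%:R * H by rewrite mulr_ge0// ltW.
  apply: (@le_trans _ _ ((4^-1 ^+ N)%:E * ((2 * rho) ^+ n * (2 * (N.+1%:R * H)))%:E)%E).
    apply: lee_wpmul2l; first by rewrite lee_fin exprn_ge0// invr_ge0.
    exact: slab_volume.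
  rewrite -EFinM lee_fin; apply: le_trans (ltW NV).
  have -> : 4^-1 ^+ N * ((2 * rho) ^+ n * (2 * (N.+1%:R * H))) =
      V / 2 ^+ N * (N.+1%:R / 2 ^+ N).
    rewrite /V exprVn (_ : 4 = 2 * 2 :> R) ?exprMn; last by rewrite -natrM.
    have u0 : 2 ^+ N != 0 :> R by rewrite expf_neq0.
    move: u0; move: (2 ^+ N) ((2 * rho) ^+ n) => u v u0.
    by field; rewrite u0.
  rewrite -[leRHS]mulr1 ler_pM2l; last by rewrite divr_gt0// exprn_gt0.
  by rewrite ler_pdivrMr ?exprn_gt0// mul1r -natrX ler_nat ltn_expl.
(* The half-heights decrease from 2 towards 1 with gaps 2^(-k-1), so the ratio of [rk k] to the gap
   is always 2 r1. *)
pose Kk (k : nat) : R := 1 + (2 ^+ k)^-1.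
pose rk (k : nat) : R := r1 / 2 ^+ k.
have p2 k : 0 < 2 ^+ k :> R by exact: exprn_gt0.
have rk0 k : 0 < rk k by rewrite divr_gt0.
have p2V k : (2 ^+ k)^-1 <= 1 :> R.
  by rewrite invf_le1// exprn_ege1// ler1n.
(* The bound is half the volume of a cube of radius [rk k], which is what permits the decay estimate
   at that scale; the factor 2^(-d) then gives the bound for half the radius. *)
have decay2 k : (mu (slab E p (Kk k)) <= ((2 * rk k) ^+ d / 2)%:E)%E.
  elim: k => [|k IH].
    rewrite /rk expr0 divr1; apply: le_trans a0; apply: subslab.
    by rewrite /Kk expr0 invr1; apply: le_trans H2; lra.
  have Kkk : Kk k - Kk k.+1 = (2 ^+ k.+1)^-1.
    rewrite /Kk exprS; have := lt0r_neq0 (p2 k); move: (2 ^+ k) => u u0.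
    by field; rewrite u0.
  have KK : Kk k.+1 < Kk k by rewrite -subr_gt0 Kkk invr_gt0.
  have tr : mu (side_trace E p (Kk k) (rho + R0)) = 0.
    apply: sub_trace trace0; apply: (@le_trans _ _ 2).
      by rewrite /Kk; have := p2V k; lra.
    apply: (le_trans H2); rewrite -[leLHS]mul1r ler_pM2r// ler1n.
    by [].
  have rkr0 : rk k <= r0.
    by apply: le_trans r1r0; rewrite /rk -[leRHS]mulr1 ler_pM2l.
  apply: (le_trans (slab_decay n_gt0 s_gt0 s_lt1 Omega_open Omega_bounded Omega_C11
    rho_gt0 Omega_rho mE Emin (rk0 k) R00 KK (farR0 _ (rk0 k) rkr0) tr _)).
    by move=> X; apply: le_trans IH; apply: le_outer_measure; exact: subIsetl.
  have -> : rk k / (Kk k - Kk k.+1) = 2 * r1.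
    rewrite Kkk /rk exprS; have := lt0r_neq0 (p2 k); move: (2 ^+ k) => u u0.
    by field; rewrite u0.
  apply: (@le_trans _ _ ((2 ^+ d)^-1%:E * ((2 * rk k) ^+ d / 2)%:E)%E).
    apply: (lee_pmul _ (outer_measure_ge0 mu _) _ IH); rewrite lee_fin//.
    by rewrite mulr_ge0 ?powR_ge0// ltW.
  rewrite -EFinM lee_fin.
  have -> : 2 * rk k.+1 = 2^-1 * (2 * rk k).
    rewrite /rk exprS; have := lt0r_neq0 (p2 k); move: (2 ^+ k) => u u0.
    by field; rewrite u0.
  by rewrite [(2^-1 * _) ^+ _]exprMn exprVn -mulrA.
apply/eqP; rewrite eq_le outer_measure_ge0 andbT.
rewrite leNgt; apply/negP => a1.
have aK k : (mu (slab E p 1) <= (eps1 / 2 ^+ k)%:E)%E.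
  apply: (@le_trans _ _ (mu (slab E p (Kk k)))).
    by apply: subslab; rewrite /Kk lerDl invr_ge0 ltW.
  apply: (le_trans (decay2 k)); rewrite lee_fin /rk mulrA exprMn exprVn.
  rewrite /eps1 mulrAC ler_pM2l ?divr_gt0 ?exprn_gt0 ?mulr_gt0//.
  rewrite lef_pV2 ?posrE ?exprn_gt0// -exprM ler_eXn2l ?ltr1n//.
  by rewrite leq_pmulr.
move: a1 aK; case: (mu _) => [a| |]//; last by move=> _ /(_ 0%N).
rewrite lte_fin => a1 /(_ (Num.bound (eps1 / a))); rewrite lee_fin leNgt => /negP; apply.
by rewrite ltr_pdivrMr ?exprn_gt0// mulrC -ltr_pdivrMr// upper_nthrootP.
Qed.

End slab_vanishes.

(** Unit slabs about the heights P + k cover the cylinder above P, those about -P - k cover it below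
    -P. They are null for E, respectively E^c, because over the ball of radius rho + R0 the graph of
    v passes below, respectively above, the window of half-height Kmax. *)
Theorem lemma4p2 (R : realType) (n : nat) (n_gt0 : (0 < n)%N)
    (s : R) (s_gt0 : 0 < s) (s_lt1 : s < 1)
    (Omega : set 'rV[R]_n) (Omega_open : open Omega)
    (Omega_bounded : bounded_set Omega) (Omega_C11 : C11_boundary Omega)
    (v : 'rV[R]_n -> R) (v_measurable : lebesgue_measurable_fun v)
    (v_bounded : locally_bounded v) :
  exists M : R, 0 < M /\
    forall E : set 'rV[R]_(n + 1),
      lebesgue_measurable E ->
      locally_minimal s E (cylinder Omega setT) ->
      eqset_ae (E `\` cylinder Omega setT)
               (subgraph v `\` cylinder Omega setT) ->
      [/\ subset_ae (cylinder Omega `]-oo, - M])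
                    (E `&` cylinder Omega setT),
          subset_ae (E `&` cylinder Omega setT)
                    (cylinder Omega `]-oo, M]) &
          eqset_ae (E `\` cylinder Omega `[- M, M])
                   (subgraph v `\` cylinder Omega `[- M, M])].
Proof.
have [rho' rho'0 Orho'] := bounded_set_le Omega_bounded.
pose rho := rho' + 1.
have rho0 : 0 < rho by rewrite addr_gt0.
have Orho x : Omega x -> `|x| < rho by move=> /Orho' h; rewrite /rho; lra.
have [R0 [Kmax [R00 Kmax0 null]]] := slab_null n_gt0 s_gt0 s_lt1 Omega_open
  Omega_bounded Omega_C11 rho0 Orho.
have sn0 : 0 < Num.sqrt n%:R :> R by rewrite sqrtr_gt0 ltr0n.
have [Cv vC] : exists Cv : R, forall x, `|x| <= rho + R0 -> `|v x| <= Cv.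
  have [|Cv vC] := v_bounded (Num.sqrt n%:R * (rho + R0)).
    by rewrite mulr_gt0// addr_gt0.
  exists Cv => x xr; apply: vC; apply: le_trans (enorm_le_norm _) _.
  by rewrite ler_pM2l.
have Cv0 : 0 <= Cv by apply: le_trans (vC 0 _); rewrite ?normr0 ?addr_ge0// ltW.
(* For |p| >= P the window of half-height Kmax about p stays beyond the bound Cv of |v|. *)
pose P := Cv + Kmax; pose M := P + 1.
have M0 : 0 < M by rewrite ltr_wpDl// addr_ge0// ltW.
have vO x : Omega x -> `|v x| <= Cv.
  by move=> /Orho xr; apply: vC; rewrite ltW// (lt_trans xr)// ltrDl.
exists M; split=> // E mE Emin EV.
have mE' : lebesgue_measurable (~` E) by exact: measurableC.
have [Emin1 Emin2] := locally_minimal_one_sided mE Emin.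
pose Bad := [set X | ~ ((E `\` cylinder Omega setT) X <->
                        (subgraph v `\` cylinder Omega setT) X)].
have Bad0 : lebesgue_outer Bad = 0 by exact: (lebesgue_aeP _).1 EV.
have up p : P <= p -> lebesgue_outer (slab Omega E p 1) = 0.
  move=> Pp; apply: null => //; apply: sub_null Bad0 => X [EX [bX OX hX]] [h _].
  have [|+ _] := h; first by split=> // -[].
  rewrite /subgraph/= ltNge => /negP; apply.
  have := vC _ bX; move: hX Pp; rewrite /hdist /P !ltr_norml ler_norml; lra.
have down p : p <= - P -> lebesgue_outer (slab Omega (~` E) p 1) = 0.
  move=> Pp; apply: null => //; apply: sub_null Bad0 => X [EX [bX OX hX]] [_ h].
  have [|+ _] := h; last by [].
  split; last by move=> [].
  rewrite /subgraph/=.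
  have := vC _ bX; move: hX Pp; rewrite /hdist /P !ltr_norml ler_norml; lra.
pose Up := \bigcup_k slab Omega E (P + k%:R) 1.
pose Down := \bigcup_k slab Omega (~` E) (- P - k%:R) 1.
have Up0 : lebesgue_outer Up = 0 by apply: null_bigcup => k; apply: up; rewrite lerDl.
have Down0 : lebesgue_outer Down = 0.
  by apply: null_bigcup => k; apply: down; rewrite gerDl oppr_le0.
have UpP X : E X -> Omega (base X) -> P <= height X -> Up X.
  move=> EX OX PX; exists (Num.trunc (height X - P)) => //; split=> //.
  have := truncn_itv (x := height X - P); rewrite subr_ge0 => /(_ PX) /andP[h1 h2].
  move: h2; rewrite /hdist/= -natr1 ltr_norml; lra.
have DownP X : ~ E X -> Omega (base X) -> height X <= - P -> Down X.
  move=> EX OX PX; exists (Num.trunc (- P - height X)) => //; split=> //.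
  have := truncn_itv (x := - P - height X); rewrite subr_ge0 => /(_ PX) /andP[h1 h2].
  move: h2; rewrite /hdist/= -natr1 ltr_norml; lra.
split.
- apply/lebesgue_aeP; apply: sub_null Down0 => X /= nX; apply: contrapT => nD.
  apply: nX => -[OX]; rewrite /= in_itv/= => hX; split; last by split.
  by apply: contrapT => EX; apply/nD/DownP => //; rewrite /M in hX; lra.
- apply/lebesgue_aeP; apply: sub_null Up0 => X /= nX; apply: contrapT => nU.
  apply: nX => -[EX [OX _]]; split=> //=; rewrite in_itv/= leNgt; apply/negP => hX.
  by apply/nU/UpP => //; rewrite /M in hX; lra.
apply/lebesgue_aeP; apply: (@sub_null _ _ _ (Bad `|` (Up `|` Down))); last first.
  by apply: nullU => //; exact: nullU.
move=> X /= nX; apply: contrapT => /not_orP [nB /not_orP [nU nD]]; apply: nX.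
have {}nB := contrapT nB.
have [OX|OX] := pselect (Omega (base X)); last first.
  have nc I : ~ cylinder Omega I X by move=> [].
  split=> -[h _]; split=> //.
    by have [] := nB.1 (conj h (nc _)).
  by have [] := nB.2 (conj h (nc _)).
(* Over Omega |v| <= Cv < M: off the exceptional null sets, a point below -M lies in both E and the
   subgraph, a point above M in neither. *)
have := vO _ OX; rewrite ler_norml => /andP[v1 v2].
have [hM|hM] := ltP (height X) (- M).
  have EX : E X by apply: contrapT => EX; apply/nD/DownP => //; rewrite /M in hM; lra.
  split=> -[h nc]; split=> //; rewrite /subgraph/=; move: hM v1; rewrite /M /P; lra.
have [hM'|hM'] := leP (height X) M.
  by split=> -[_ []]; split=> //=; rewrite in_itv/= hM.
split=> -[h nc].
  by exfalso; apply/nU/UpP => //; rewrite /M in hM'; lra.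
by exfalso; move: h hM' v2; rewrite /subgraph/= /M /P; lra.
Qed.
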